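(* INF proves that the Church counting axiom, $\forall j\in\mathbb{N}\,(j\,\mathsf{S}\,\mathbf{0}=j)$, implies the Rosser counting axiom, $\forall x\in\mathbb{F}\,(\{z\in\mathbb{F}:z<x\}\in x)$.
   Context: INF (intuitionistic New Foundations) is the first-order theory with equality over intuitionistic logic, with one binary predicate $\in$, whose axioms are extensionality ($\forall z(z\in x\leftrightarrow z\in y)\to x=y$) and stratified comprehension (the set $\{x:\varphi\}$ exists for every stratified $\varphi$, parameters allowed; $\varphi$ is stratified if its variables can be assigned natural-number indices so that in each subformula $x\in y$ the index of $y$ is one more than that of $x$, and in each $x=y$ the indices agree). Ordered pairs are $\langle x,y\rangle=\{\{x\},\{x,y\}\}$. $\mathrm{FUNC}=\{f:\forall x,y,z(\langle x,y\rangle\in f\to\langle x,z\rangle\in f\to y=z)\}$. Application: $Ap(f,x)=\{t:\exists y(\langle x,y\rangle\in f\land t\in y)\}$, so $Ap(f,x)=y$ if $f\in\mathrm{FUNC}$ and $\langle x,y\rangle\in f$. Write $fx$ for $Ap(f,x)$, associating to the left; so $j\,\mathsf{S}\,\mathbf{0}$ means $Ap(Ap(j,\mathsf{S}),\mathbf{0})$. Church numbers: $\mathbf{0}=\{\langle f,\mathrm{id}\rangle: f=f\}$ with $\mathrm{id}=\{\langle x,x\rangle:x=x\}$. Church successor is the set of all pairs $\langle z,s_z\rangle$ with $z\in\mathrm{FUNC}$, where $s_z$ is the set of all $\langle f,p\rangle$ with $f\in\mathrm{FUNC}$ and $\forall u\,(u\in p\leftrightarrow\exists x,w,t,q\,(u=\langle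 x,w\rangle\land t\in\mathrm{FUNC}\land\langle f,t\rangle\in z\land\langle x,q\rangle\in t\land\langle q,w\rangle\in f))$; it is denoted $\mathsf{S}$. $\mathbb{N}$ is the intersection of all sets containing $\mathbf{0}$ and closed under $\mathsf{S}$. Frege cardinals: $\mathsf{zero}=\{\emptyset\}$; the Frege successor of $x$ is $x^+=\{u\cup\{c\}: u\in x,\ c\notin u\}$; $\mathbb{F}$ (the finite Frege cardinals) is the intersection of all sets $w$ with $\mathsf{zero}\in w$ and $\forall x\,(x\in w\land\exists u(u\in x^+)\to x^+\in w)$. Order on $\mathbb{F}$: $x\le y$ means there are $a\in x$, $b\in y$ with $a\subseteq b$ and $b=a\cup(b-a)$ ($a$ is a separable subset of $b$); $x<y$ means $x\le y$ and $x\ne y$. *)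

(* Defs.v *)
From Stdlib Require Import List.
Import ListNotations.

(* The language has no function symbols, so the only terms are variables,
   written as de Bruijn indices; substitution is then renaming of indices. *)
Inductive form : Set :=
| Mem (x y : nat)
| Eq (x y : nat)
| Bot
| And (A B : form)
| Or (A B : form)
| Imp (A B : form)
| All (A : form)
| Ex (A : form).

Definition Iff (A B : form) : form := And (Imp A B) (Imp B A).

Definition scons (x : nat) (r : nat -> nat) (n : nat) : nat :=
  match n with 0 => x | S m => r m end.

Definition up (r : nat -> nat) : nat -> nat := scons 0 (fun n => S (r n)).

Fixpoint ren (r : nat -> nat) (A : form) : form :=
  match A with
  | Mem x y => Mem (r x) (r y)
  | Eq x y => Eq (r x) (r y)
  | Bot => Bot
  | And A B => And (ren r A) (ren r B)
  | Or A B => Or (ren r A) (ren r B)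
  | Imp A B => Imp (ren r A) (ren r B)
  | All A => All (ren (up r) A)
  | Ex A => Ex (ren (up r) A)
  end.

Definition shift : form -> form := ren S.

(* [inst x A] is A[x/0]: the outermost bound variable is replaced by x. *)
Definition inst (x : nat) : form -> form := ren (scons x (fun n => n)).

(* Natural deduction for intuitionistic first-order logic with equality.
   Free variables of an axiom are read as universally quantified: [prv_ax]
   may be used below any context, so [prv_allI] generalizes over them. *)
Inductive prv (T : form -> Prop) : list form -> form -> Prop :=
| prv_ax G A : T A -> prv T G A
| prv_hyp G A : In A G -> prv T G A
| prv_botE G A : prv T G Bot -> prv T G A
| prv_andI G A B : prv T G A -> prv T G B -> prv T G (And A B)
| prv_andE1 G A B : prv T G (And A B) -> prv T G A
| prv_andE2 G A B : prv T G (And A B) -> prv T G B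
| prv_orI1 G A B : prv T G A -> prv T G (Or A B)
| prv_orI2 G A B : prv T G B -> prv T G (Or A B)
| prv_orE G A B C :
    prv T G (Or A B) -> prv T (A :: G) C -> prv T (B :: G) C -> prv T G C
| prv_impI G A B : prv T (A :: G) B -> prv T G (Imp A B)
| prv_impE G A B : prv T G (Imp A B) -> prv T G A -> prv T G B
| prv_allI G A : prv T (map shift G) A -> prv T G (All A)
| prv_allE G A x : prv T G (All A) -> prv T G (inst x A)
| prv_exI G A x : prv T G (inst x A) -> prv T G (Ex A)
| prv_exE G A C :
    prv T G (Ex A) -> prv T (A :: map shift G) (shift C) -> prv T G C
| prv_eqI G x : prv T G (Eq x x)
| prv_eqE G A x y :
    prv T G (Eq x y) -> prv T G (inst x A) -> prv T G (inst y A).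

Definition provable (T : form -> Prop) (A : form) : Prop := prv T [] A.

(* Each binder gets its own index, as after renaming bound variables apart;
   [s] assigns indices to the free variables, parameters included. *)
Fixpoint stratified_by (s : nat -> nat) (A : form) : Prop :=
  match A with
  | Mem x y => s y = S (s x)
  | Eq x y => s x = s y
  | Bot => True
  | And A B | Or A B | Imp A B => stratified_by s A /\ stratified_by s B
  | All A | Ex A => exists k, stratified_by (scons k s) A
  end.

Definition stratified (A : form) : Prop := exists s, stratified_by s A.

(* In [INF_comprehension] variable 0 of A is the x of {x : A}, and the others
   are parameters; [up S] makes room for the set being asserted to exist. *)
Inductive INF : form -> Prop :=
| INF_extensionality :
    INF (All (All (Imp (All (Iff (Mem 0 2) (Mem 0 1))) (Eq 1 0))))
| INF_comprehension A :
    stratified A -> INF (Ex (All (Iff (Mem 0 1) (ren (up S) A)))).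

(* Formulas with named bound variables: an [fm] produces a formula from the
   number d of enclosing binders, and a variable is represented by the number
   of binders enclosing its own binder (its de Bruijn level). *)
Definition fm : Set := nat -> form.

Definition index (d v : nat) : nat := d - S v.

(* Set abstracts are not part of the language: [Abs P] stands for {x : P x}
   and is eliminated contextually by [tMem] and [tEq]. *)
Inductive tm : Set :=
| Var (v : nat)
| Abs (P : nat -> fm).

Definition abs (P : tm -> fm) : tm := Abs (fun v => P (Var v)).

Definition fBot : fm := fun _ => Bot.
Definition fAnd (A B : fm) : fm := fun d => And (A d) (B d).
Definition fOr (A B : fm) : fm := fun d => Or (A d) (B d).
Definition fImp (A B : fm) : fm := fun d => Imp (A d) (B d).
Definition fIff (A B : fm) : fm := fun d => Iff (A d) (B d).
Definition fNot (A : fm) : fm := fImp A fBot.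
Definition fAll (F : tm -> fm) : fm := fun d => All (F (Var d) (S d)).
Definition fEx (F : tm -> fm) : fm := fun d => Ex (F (Var d) (S d)).

Definition var_mem (x : nat) (b : tm) : fm :=
  match b with
  | Var y => fun d => Mem (index d x) (index d y)
  | Abs P => P x
  end.

Definition tEq (a b : tm) : fm :=
  match a, b with
  | Var x, Var y => fun d => Eq (index d x) (index d y)
  | _, _ => fun d => All (Iff (var_mem d a (S d)) (var_mem d b (S d)))
  end.

Definition tMem (a b : tm) : fm :=
  match a with
  | Var x => var_mem x b
  | Abs _ => fun d => Ex (And (tEq (Var d) a (S d)) (var_mem d b (S d)))
  end.

Definition sentence (A : fm) : form := A 0.

Declare Scope fm_scope.
Delimit Scope fm_scope with fm.
Bind Scope fm_scope with fm.
Bind Scope fm_scope with tm.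

Notation "a ∈ b" := (tMem a b) (at level 70, no associativity) : fm_scope.
Notation "a ∉ b" := (fNot (tMem a b)) (at level 70, no associativity) : fm_scope.
Notation "a ≡ b" := (tEq a b) (at level 70, no associativity) : fm_scope.
Notation "A ∧ B" := (fAnd A B) (at level 80, right associativity) : fm_scope.
Notation "A ∨ B" := (fOr A B) (at level 85, right associativity) : fm_scope.
Notation "A ⇒ B" := (fImp A B) (at level 90, right associativity) : fm_scope.
Notation "A ⇔ B" := (fIff A B) (at level 95, no associativity) : fm_scope.
Notation "∀ x .. y , A" := (fAll (fun x => .. (fAll (fun y => A)) ..))
  (at level 200, x binder, y binder, right associativity) : fm_scope.
Notation "∃ x .. y , A" := (fEx (fun x => .. (fEx (fun y => A)) ..))
  (at level 200, x binder, y binder, right associativity) : fm_scope.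
Notation "⦃ x | A ⦄" := (abs (fun x => A))
  (at level 0, x name, A at level 200) : fm_scope.

Local Open Scope fm_scope.

Definition empty : tm := ⦃ x | fBot ⦄.
Definition singleton (a : tm) : tm := ⦃ u | u ≡ a ⦄.
Definition doubleton (a b : tm) : tm := ⦃ u | u ≡ a ∨ u ≡ b ⦄.
Definition opair (a b : tm) : tm := doubleton (singleton a) (doubleton a b).
Definition union (a b : tm) : tm := ⦃ t | t ∈ a ∨ t ∈ b ⦄.
Definition diff (a b : tm) : tm := ⦃ t | t ∈ a ∧ t ∉ b ⦄.
Definition subset (a b : tm) : fm := ∀ t, t ∈ a ⇒ t ∈ b.

Definition FUNC : tm :=
  ⦃ f | ∀ x y z, opair x y ∈ f ⇒ opair x z ∈ f ⇒ y ≡ z ⦄.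
Definition Ap (f x : tm) : tm := ⦃ t | ∃ y, opair x y ∈ f ∧ t ∈ y ⦄.

Definition id_set : tm := ⦃ u | ∃ x, x ≡ x ∧ u ≡ opair x x ⦄.
Definition church_zero : tm := ⦃ u | ∃ f, f ≡ f ∧ u ≡ opair f id_set ⦄.
Definition church_step (z : tm) : tm :=
  ⦃ v | ∃ f p, f ∈ FUNC
      ∧ (∀ u, u ∈ p ⇔
           ∃ x w t q, u ≡ opair x w ∧ t ∈ FUNC ∧ opair f t ∈ z
                        ∧ opair x q ∈ t ∧ opair q w ∈ f)
      ∧ v ≡ opair f p ⦄.
Definition church_succ : tm :=
  ⦃ v | ∃ z, z ∈ FUNC ∧ v ≡ opair z (church_step z) ⦄.
Definition Church : tm :=
  ⦃ n | ∀ w, church_zero ∈ w ∧ (∀ x, x ∈ w ⇒ Ap church_succ x ∈ w) ⇒ n ∈ w ⦄.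

Definition frege_zero : tm := singleton empty.
Definition frege_succ (x : tm) : tm :=
  ⦃ v | ∃ u c, u ∈ x ∧ c ∉ u ∧ v ≡ union u (singleton c) ⦄.
Definition Frege : tm :=
  ⦃ n | ∀ w, frege_zero ∈ w
      ∧ (∀ x, x ∈ w ∧ (∃ u, u ∈ frege_succ x) ⇒ frege_succ x ∈ w) ⇒ n ∈ w ⦄.
Definition frege_le (x y : tm) : fm :=
  ∃ a b, a ∈ x ∧ b ∈ y ∧ subset a b ∧ b ≡ union a (diff b a).
Definition frege_lt (x y : tm) : fm := frege_le x y ∧ fNot (x ≡ y).

Definition church_counting : fm :=
  ∀ j, j ∈ Church ⇒ Ap (Ap j church_succ) church_zero ≡ j.
Definition rosser_counting : fm :=
  ∀ x, x ∈ Frege ⇒ ⦃ z | z ∈ Frege ∧ frege_lt z x ⦄ ∈ x.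

(* Main.v *)
(* Let R(x,y), below SegCard, mean that the set of Frege cardinals below x
   belongs to y. R respects successors and is strictly monotone, and it raises the type by two.
   Every x in F is j FS 0 for some Church number j, FS being the Frege
   successor function. Put k = j S 0, which lies six types below j. A
   stratified induction on j shows that k FS 0 and j FS 0 are linked by the
   threefold composite of R, and the Church counting axiom says k = j; hence
   R(x,y), R(y,z) and R(z,x) for some y and z. As F is linearly ordered and R is
   strictly monotone, such a cycle is impossible unless x = y, so R(x,x).

   Derivability is handled semantically: a formula denotes the set of contexts
   from which it is derivable, and the argument takes place in the complete
   Heyting algebra of such sets; [adequacy] leads back to derivations. *)

From Stdlib Require Import List Arith Lia.
Require Import Defs.
Import ListNotations.

(** The number three comes from the coding of pairs. A Kuratowski pair lies two types above its
    components, so a function lies three types above its arguments, and a Church number, a function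
    on functions, six above the objects that it iterates on; each R climbs two. The infinity of F is
    not at hand, so a Frege successor might be empty, and inductions carry a witness that the next
    cardinal is inhabited. R hands such witnesses upwards: the initial segment below the successor
    of x is itself a member of the successor of y. Intuitionistically, comparing x with y in the
    cycle argument needs a proof of trichotomy; it rests on [Sep_dec], which decides by induction
    whether a separable subset of a finite set is all of it. The cycle R(x,y), R(y,z), R(z,x) admits
    no typing, so it is refuted by instances of laws that were proved by stratified inductions. *)

Lemma up_ext r r' : (forall n, r n = r' n) -> forall n, up r n = up r' n.
Proof. intros H [|n]; cbn; auto. Qed.

Lemma ren_ext A : forall r r', (forall n, r n = r' n) -> ren r A = ren r' A.
Proof.
  induction A; intros r r' H; cbn; f_equal; auto using up_ext.
Qed.

Lemma ren_ren A : forall r r', ren r (ren r' A) = ren (fun n => r (r' n)) A.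
Proof.
  induction A; intros r r'; cbn; f_equal; auto;
    rewrite IHA; apply ren_ext; intros [|n]; reflexivity.
Qed.

Lemma ren_id A : forall r, (forall n, r n = n) -> ren r A = A.
Proof.
  induction A; intros r H; cbn; f_equal; auto;
    apply IHA; intros [|n]; cbn; auto.
Qed.

Fixpoint vbound (A : form) : nat :=
  match A with
  | Mem x y | Eq x y => S (max x y)
  | Bot => 0
  | And A B | Or A B | Imp A B => max (vbound A) (vbound B)
  | All A | Ex A => vbound A - 1
  end.

Lemma ren_bound A : forall r r',
  (forall n, n < vbound A -> r n = r' n) -> ren r A = ren r' A.
Proof.
  induction A as [| | |A IHA B IHB|A IHA B IHB|A IHA B IHB|A IHA|A IHA];
    intros r r' H; cbn in *; f_equal; try (apply H; lia);
    try (apply IHA; intros [|n] Hn; cbn; auto; f_equal; apply H; lia).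
  all: first [reflexivity | apply IHA | apply IHB]; intros n Hn; apply H; lia.
Qed.

Lemma inst_ren x r A : inst x (ren (up r) A) = ren (scons x r) A.
Proof. unfold inst. rewrite ren_ren. apply ren_ext. intros [|n]; reflexivity. Qed.

Lemma ren_inst r x A : ren r (inst x A) = inst (r x) (ren (up r) A).
Proof.
  rewrite inst_ren. unfold inst. rewrite ren_ren.
  apply ren_ext. intros [|n]; reflexivity.
Qed.

Lemma ren_shift r A : ren (up r) (shift A) = shift (ren r A).
Proof. unfold shift. rewrite !ren_ren. apply ren_ext. reflexivity. Qed.

Lemma map_ren_shift r G : map (ren (up r)) (map shift G) = map shift (map (ren r) G).
Proof. rewrite !map_map. apply map_ext. intros A. apply ren_shift. Qed.

(** * Derivations under renaming, weakening and fresh variables *)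

Lemma stratified_by_ren A : forall r s s',
  (forall n, s' (r n) = s n) -> stratified_by s A -> stratified_by s' (ren r A).
Proof.
  induction A; intros r s s' H; cbn; rewrite ?H; auto.
  1-3: intros [H1 H2]; eauto.
  all: intros [k Hk]; exists k; eapply IHA; [|exact Hk]; intros [|n]; cbn; auto.
Qed.

(* Only renamings with a left inverse are allowed: identifying two parameters
   may destroy the stratification of a comprehension formula. *)
Lemma INF_ren r r' A : (forall n, r' (r n) = n) -> INF A -> INF (ren r A).
Proof.
  intros H [|B [s Hs]].
  - exact INF_extensionality.
  - cbn. replace (ren (up (up r)) (ren (up S) B)) with (ren (up S) (ren (up r) B)).
    + apply INF_comprehension. exists (fun n => s (up r' n)).
      eapply stratified_by_ren; [|exact Hs].
      intros [|n]; cbn; [reflexivity|]. now rewrite H.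
    + rewrite !ren_ren. apply ren_ext. intros [|n]; reflexivity.
Qed.

Lemma prv_ren G A : prv INF G A ->
  forall r r', (forall n, r' (r n) = n) -> prv INF (map (ren r) G) (ren r A).
Proof.
  assert (Hup : forall r r' : nat -> nat,
             (forall n, r' (r n) = n) -> forall n, up r' (up r n) = n).
  { intros r r' H [|n]; cbn; auto. }
  induction 1; intros r r' Hr; cbn in *.
  - apply prv_ax. eauto using INF_ren.
  - apply prv_hyp. now apply in_map.
  - apply prv_botE. eauto.
  - apply prv_andI; eauto.
  - eapply prv_andE1; eauto.
  - eapply prv_andE2; eauto.
  - apply prv_orI1; eauto.
  - apply prv_orI2; eauto.
  - eapply prv_orE; eauto.
  - apply prv_impI; eauto.
  - eapply prv_impE; eauto.
  - apply prv_allI. rewrite <- map_ren_shift. eauto.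
  - rewrite ren_inst. apply prv_allE. eauto.
  - apply prv_exI with (x := r x). rewrite <- ren_inst. eauto.
  - eapply prv_exE; eauto.
    specialize (IHprv2 (up r) (up r') (Hup _ _ Hr)).
    now rewrite map_ren_shift, ren_shift in IHprv2.
  - apply prv_eqI.
  - rewrite ren_inst. eapply prv_eqE; eauto. rewrite <- ren_inst. eauto.
Qed.

Lemma prv_weak T G A : prv T G A -> forall G', incl G G' -> prv T G' A.
Proof.
  induction 1; intros G' Hi.
  - now apply prv_ax.
  - apply prv_hyp; auto.
  - apply prv_botE; auto.
  - apply prv_andI; auto.
  - eapply prv_andE1; eauto.
  - eapply prv_andE2; eauto.
  - apply prv_orI1; auto.
  - apply prv_orI2; auto.
  - eapply prv_orE; [eauto | apply IHprv2 | apply IHprv3];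
      apply incl_cons; auto using in_eq, incl_tl.
  - apply prv_impI; apply IHprv; apply incl_cons; auto using in_eq, incl_tl.
  - eapply prv_impE; eauto.
  - apply prv_allI; apply IHprv. now apply incl_map.
  - apply prv_allE; auto.
  - eapply prv_exI; eauto.
  - eapply prv_exE; eauto. apply IHprv2. apply incl_cons; auto using in_eq.
    apply incl_tl. now apply incl_map.
  - apply prv_eqI.
  - eapply prv_eqE; eauto.
Qed.

(** A variable [m] beyond all those of [G] and [A] is generic. The instance at [m] is carried back
    by the renaming that sends [m] to 0 and shifts the rest; it has a left inverse, as [prv_ren]
    demands. *)
Lemma prv_fresh G A :
  (forall x, prv INF (map (inst x) G) (inst x A)) -> prv INF G A.
Proof.
  intros H.
  set (m := fold_right max (vbound A) (map vbound G)).
  assert (Hm : forall B, B = A \/ In B G -> vbound B <= m).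
  { subst m. clear H. induction G as [|D G IH]; cbn; intros B [->|HB]; auto; try tauto.
    - specialize (IH A (or_introl eq_refl)). lia.
    - destruct HB as [->|HB]; [lia|]. specialize (IH B (or_intror HB)). lia. }
  set (r := fun n => if n =? m then 0 else S n).
  assert (Hr : forall B, B = A \/ In B G -> ren r (inst m B) = B).
  { intros B HB. unfold inst. rewrite ren_ren.
    transitivity (ren (fun n => n) B); [|now apply ren_id].
    apply ren_bound. intros [|n] Hn; unfold r; cbn.
    - now rewrite Nat.eqb_refl.
    - specialize (Hm B HB). destruct (n =? m) eqn:E; auto.
      apply Nat.eqb_eq in E. lia. }
  rewrite <- (Hr A) by auto.
  replace G with (map (ren r) (map (inst m) G)).
  - apply (prv_ren _ _ (H m) r (scons m (fun n => n))).
    intros n. unfold r. destruct (n =? m) eqn:E; cbn; auto.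
    now apply Nat.eqb_eq in E.
  - rewrite map_map. transitivity (map (fun B => B) G); [|apply map_id].
    apply map_ext_in. intros B HB. auto.
Qed.

Lemma inst_shift x A : inst x (shift A) = A.
Proof. unfold inst, shift. rewrite ren_ren. now apply ren_id. Qed.

Lemma map_inst_shift x G : map (inst x) (map shift G) = G.
Proof.
  rewrite map_map. transitivity (map (fun B => B) G); [|apply map_id].
  apply map_ext. apply inst_shift.
Qed.

(** This is why [tall] can be a plain intersection over all variables, with no renaming of
    contexts. *)
Lemma prv_all G A : (forall x, prv INF G (inst x A)) -> prv INF G (All A).
Proof.
  intros H. apply prv_allI, prv_fresh; auto. intros x. now rewrite map_inst_shift.
Qed.

Lemma prv_ex G A C :
  prv INF G (Ex A) -> (forall x, prv INF (inst x A :: G) C) -> prv INF G C.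
Proof.
  intros HA HC. apply (prv_exE _ _ _ _ HA), prv_fresh; auto.
  intros x. cbn. now rewrite map_inst_shift, inst_shift.
Qed.

(** * Truth values and forcing *)

(* A truth value is a set of contexts, ordered by inclusion of contexts.
   [local] makes it closed under the eliminations of Bot, Or and Ex performed by
   [prv], so that these connectives can be eliminated into any truth value. *)
Record tv : Type := Tv {
  at_ :> list form -> Prop;
  mono : forall w w', incl w w' -> at_ w -> at_ w';
  local : forall w,
    (forall w' C, incl w w' ->
       (forall w'', incl w' w'' -> at_ w'' -> prv INF w'' C) -> prv INF w' C) ->
    at_ w
}.

Definition holds (w : list form) (P : tv) : Prop := at_ P w.

Declare Scope tv_scope.
Delimit Scope tv_scope with tv.
Bind Scope tv_scope with tv.
Local Open Scope tv_scope.

Notation "w ⊩ P" := (holds w P%tv) (at level 99, P at level 200, no associativity).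

Program Definition tPrv (A : form) : tv := {| at_ w := prv INF w A |}.
Next Obligation. eauto using prv_weak. Qed.
Next Obligation. apply H; auto using incl_refl. Qed.

Definition tmem (x y : nat) : tv := tPrv (Mem x y).
Definition teq (x y : nat) : tv := tPrv (Eq x y).
Definition tbot : tv := tPrv Bot.

Program Definition tand (P Q : tv) : tv := {| at_ w := P w /\ Q w |}.
Next Obligation. eauto using mono. Qed.
Next Obligation.
  split; apply local; intros w' C Hw HC; apply H; auto; intros w'' Hw' []; auto.
Qed.

Program Definition timp (P Q : tv) : tv :=
  {| at_ w := forall w', incl w w' -> P w' -> Q w' |}.
Next Obligation. eauto using incl_tran. Qed.
Next Obligation.
  apply local; intros w1 C Hw1 HC. apply H.
  - eauto using incl_tran.
  - intros w2 Hw2 HPQ. apply HC; auto. apply HPQ; auto using incl_refl.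
    apply (mono P w'); eauto using incl_tran.
Qed.

Program Definition tall (P : nat -> tv) : tv := {| at_ w := forall x, P x w |}.
Next Obligation. eauto using mono. Qed.
Next Obligation.
  apply local; intros w' C Hw HC. apply H; auto.
Qed.

(** The union of two truth values need not be local: a disjunction may be derivable where neither
    side is. Hence disjunction, and likewise [tex], is encoded by its elimination into derivable
    formulas. *)
Program Definition tor (P Q : tv) : tv :=
  {| at_ w := forall w' C, incl w w' ->
       (forall w'', incl w' w'' -> P w'' -> prv INF w'' C) ->
       (forall w'', incl w' w'' -> Q w'' -> prv INF w'' C) -> prv INF w' C |}.
Next Obligation. apply H0; eauto using incl_tran. Qed.
Next Obligation.
  apply H; auto. intros w2 Hw2 HPQ.
  apply HPQ; auto using incl_refl; intros w3 Hw3; eauto using incl_tran.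
Qed.

Program Definition tex (P : nat -> tv) : tv :=
  {| at_ w := forall w' C, incl w w' ->
       (forall x w'', incl w' w'' -> P x w'' -> prv INF w'' C) -> prv INF w' C |}.
Next Obligation. apply H0; eauto using incl_tran. Qed.
Next Obligation.
  apply H; auto. intros w2 Hw2 HPQ.
  apply HPQ; auto using incl_refl; intros x w3 Hw3; eauto using incl_tran.
Qed.

Definition tiff (P Q : tv) : tv := tand (timp P Q) (timp Q P).
Definition tnot (P : tv) : tv := timp P tbot.

Notation "x ∈ y" := (tmem x y) : tv_scope.
Notation "x ∉ y" := (tnot (tmem x y)) : tv_scope.
Notation "x ≡ y" := (teq x y) : tv_scope.
Notation "P ∧ Q" := (tand P Q) : tv_scope.
Notation "P ∨ Q" := (tor P Q) : tv_scope.
Notation "P ⇒ Q" := (timp P Q) : tv_scope.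
Notation "P ⇔ Q" := (tiff P Q) : tv_scope.
Notation "¬ P" := (tnot P) (at level 75, right associativity) : tv_scope.
Notation "∀ x .. y , P" := (tall (fun x => .. (tall (fun y => P)) ..)) : tv_scope.
Notation "∃ x .. y , P" := (tex (fun x => .. (tex (fun y => P)) ..)) : tv_scope.

Lemma up_world w w' (P : tv) : incl w w' -> (w ⊩ P) -> w' ⊩ P.
Proof. apply mono. Qed.

Lemma imp_i w P Q : (forall w', incl w w' -> (w' ⊩ P) -> w' ⊩ Q) -> w ⊩ P ⇒ Q.
Proof. exact (fun H => H). Qed.

Lemma mp w P Q : (w ⊩ P ⇒ Q) -> (w ⊩ P) -> w ⊩ Q.
Proof. intros H. apply H, incl_refl. Qed.

Lemma iff_i w P Q : (w ⊩ P ⇒ Q) -> (w ⊩ Q ⇒ P) -> w ⊩ P ⇔ Q.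
Proof. exact (@conj _ _). Qed.

Lemma iff_l w P Q : (w ⊩ P ⇔ Q) -> (w ⊩ P) -> w ⊩ Q.
Proof. intros [H _]. now apply mp. Qed.

Lemma iff_r w P Q : (w ⊩ P ⇔ Q) -> (w ⊩ Q) -> w ⊩ P.
Proof. intros [_ H]. now apply mp. Qed.

Lemma or_l w P Q : (w ⊩ P) -> w ⊩ P ∨ Q.
Proof. intros H w' C Hw HP _. apply HP; auto using incl_refl. eapply mono; eauto. Qed.

Lemma or_r w P Q : (w ⊩ Q) -> w ⊩ P ∨ Q.
Proof. intros H w' C Hw _ HP. apply HP; auto using incl_refl. eapply mono; eauto. Qed.

Lemma or_e w P Q C : (w ⊩ P ∨ Q) ->
  (forall w', incl w w' -> (w' ⊩ P) -> w' ⊩ C) ->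
  (forall w', incl w w' -> (w' ⊩ Q) -> w' ⊩ C) -> w ⊩ C.
Proof.
  intros H HP HQ. apply local; intros w' D Hw HD.
  apply H; auto; intros w'' Hw''; intros; apply HD; auto;
    [apply HP | apply HQ]; eauto using incl_tran.
Qed.

Lemma ex_i w P x : (w ⊩ P x) -> w ⊩ tex P.
Proof. intros H w' C Hw HP. apply (HP x); auto using incl_refl. eapply mono; eauto. Qed.

Lemma ex_e w P C : (w ⊩ tex P) ->
  (forall x w', incl w w' -> (w' ⊩ P x) -> w' ⊩ C) -> w ⊩ C.
Proof.
  intros H HP. apply local; intros w' D Hw HD.
  apply H; auto; intros x w'' Hw''; intros; apply HD; auto;
    apply (HP x); eauto using incl_tran.
Qed.

Lemma bot_e w (P : tv) : (w ⊩ tbot) -> w ⊩ P.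
Proof.
  intros H. apply local; intros w' C Hw _. apply prv_botE, (prv_weak _ _ _ H _ Hw).
Qed.

(** * Evaluation of formulas and the axioms of INF *)

Fixpoint ev (A : form) (r : nat -> nat) : tv :=
  match A with
  | Mem x y => r x ∈ r y
  | Eq x y => r x ≡ r y
  | Bot => tbot
  | And A B => ev A r ∧ ev B r
  | Or A B => ev A r ∨ ev B r
  | Imp A B => ev A r ⇒ ev B r
  | All A => ∀ x, ev A (scons x r)
  | Ex A => ∃ x, ev A (scons x r)
  end.

(** For [Or] and [Ex], the formula itself is taken as the target of the encoded elimination in one
    direction; in the other, the elimination rules of [prv] apply. The quantifier cases rest on
    [prv_all] and [prv_ex]. *)
Lemma adequacy A : forall r w, (w ⊩ ev A r) <-> prv INF w (ren r A).
Proof.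
  induction A as [| | |A IHA B IHB|A IHA B IHB|A IHA B IHB|A IHA|A IHA];
    intros r w; cbn; try reflexivity.
  - split.
    + intros [H1 H2]. apply prv_andI; [apply IHA | apply IHB]; assumption.
    + intros H. split; [apply IHA; eapply prv_andE1 | apply IHB; eapply prv_andE2]; exact H.
  - split.
    + intros H. apply (H w); auto using incl_refl; intros w' Hw HP.
      * apply prv_orI1, IHA, HP.
      * apply prv_orI2, IHB, HP.
    + intros H w' C Hw HA HB. eapply prv_orE.
      * eapply prv_weak; eauto.
      * apply HA; auto using incl_tl, incl_refl. apply IHA. apply prv_hyp, in_eq.
      * apply HB; auto using incl_tl, incl_refl. apply IHB. apply prv_hyp, in_eq.
  - split.
    + intros H. apply prv_impI, IHB, H; auto using incl_tl, incl_refl.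
      apply IHA, prv_hyp, in_eq.
    + intros H w' Hw HA. apply IHB. eapply prv_impE.
      * eapply prv_weak; eauto.
      * now apply IHA.
  - split.
    + intros H. apply prv_all. intros x. rewrite inst_ren. apply IHA, H.
    + intros H x. apply IHA. rewrite <- inst_ren. now apply prv_allE.
  - split.
    + intros H. apply H; auto using incl_refl. intros x w' Hw HP.
      apply prv_exI with (x := x). rewrite inst_ren. apply IHA, HP.
    + intros H w' C Hw HP. eapply prv_ex.
      * eapply prv_weak; eauto.
      * intros x. rewrite inst_ren. apply (HP x); auto using incl_tl, incl_refl.
        apply IHA, prv_hyp, in_eq.
Qed.

Lemma ev_ren A r r' w : (w ⊩ ev (ren r' A) r) <-> (w ⊩ ev A (fun n => r (r' n))).
Proof. rewrite !adequacy, ren_ren. reflexivity. Qed.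

Lemma ev_ext A r r' w : (forall n, r n = r' n) -> (w ⊩ ev A r) <-> (w ⊩ ev A r').
Proof. intros H. rewrite !adequacy, (ren_ext A r r' H). reflexivity. Qed.

Definition env (l : list nat) : nat -> nat := fold_right scons (fun n => n) l.

(* The parameters of a comprehension axiom need not be distinct variables, so
   they are instantiated in the universal closure of the axiom. *)
Lemma generalize A : (forall w, prv INF w A) -> forall l w, w ⊩ ev A (env l).
Proof.
  intros H.
  assert (Hn : forall n w, prv INF w (Nat.iter n All A)).
  { induction n as [|n IH]; intros w; cbn; auto. now apply prv_allI. }
  enough (Hi : forall l n w, w ⊩ ev (Nat.iter n All A) (env l)).
  { intros l w. exact (Hi l 0 w). }
  induction l as [|x l IH]; intros n w.
  - apply adequacy. rewrite ren_id by reflexivity. apply Hn.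
  - exact (IH (S n) w x).
Qed.

Lemma comprehension A l w : stratified A ->
  w ⊩ ∃ y, ∀ x, x ∈ y ⇔ ev A (env (x :: l)).
Proof.
  intros HA.
  assert (H := generalize _ (fun w => prv_ax _ w _ (INF_comprehension A HA)) l w).
  cbn [ev Iff scons] in H. apply (ex_e _ _ _ H). intros y w' _ Hy. apply (ex_i _ _ y). intros x.
  specialize (Hy x). destruct Hy as [H1 H2].
  (* The asserted set [y] sits at index 1, and [up S] jumps over it. *)
  assert (E : forall w0, (w0 ⊩ ev (ren (up S) A) (scons x (scons y (env l)))) <->
                         (w0 ⊩ ev A (env (x :: l)))).
  { intros w0. rewrite ev_ren. apply ev_ext. intros [|n]; reflexivity. }
  split; intros w1 Hw1 Hx.
  - apply E. exact (H1 w1 Hw1 Hx).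
  - apply (H2 w1 Hw1), E, Hx.
Qed.

Lemma extensionality x y w : (w ⊩ ∀ t, t ∈ x ⇔ t ∈ y) -> w ⊩ x ≡ y.
Proof.
  intros H.
  assert (E := generalize _ (fun w => prv_ax _ w _ INF_extensionality) [] w).
  exact (mp _ _ _ (E x y) H).
Qed.

Lemma eq_refl_tv x w : w ⊩ x ≡ x.
Proof. apply prv_eqI. Qed.

(** No stratification is asked of [A], so equals may be exchanged even between objects used at
    different types. *)
Lemma transport A l x y w :
  (w ⊩ x ≡ y) -> (w ⊩ ev A (env (x :: l))) -> w ⊩ ev A (env (y :: l)).
Proof.
  cbn [env fold_right]. rewrite !adequacy. rewrite <- !inst_ren. apply prv_eqE.
Qed.

(* Makes the conversion between [ev A r] and the truth value that [A] was
   quoted from compare connective by connective; unfolding a connective first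
   duplicates its arguments. *)
Strategy 1000 [tall tex timp tand tor tmem teq tbot holds].
Strategy expand [ev env].

(** * Reasoning in a truth value *)

(* The tactics below keep one context w at a time: the goal and all hypotheses
   have the form [w ⊩ P], and whenever a step enlarges w the hypotheses are
   transported to the larger context by [lift_all]. *)

Lemma all_i w P : (forall x, w ⊩ P x) -> w ⊩ tall P.
Proof. exact (fun H => H). Qed.
Lemma all_e w P : (w ⊩ tall P) -> forall x, w ⊩ P x.
Proof. exact (fun H => H). Qed.
Lemma and_i w P Q : (w ⊩ P) -> (w ⊩ Q) -> w ⊩ P ∧ Q.
Proof. exact (@conj _ _). Qed.
Lemma and_e w P Q : (w ⊩ P ∧ Q) -> (w ⊩ P) /\ (w ⊩ Q).
Proof. exact (fun H => H). Qed.
Lemma iff_e w P Q : (w ⊩ P ⇔ Q) -> ((w ⊩ P) -> (w ⊩ Q)) /\ ((w ⊩ Q) -> (w ⊩ P)).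
Proof. intros H. split; [eapply iff_l | eapply iff_r]; exact H. Qed.

(* When a truth value is to be proved, a hypothesis [P] may be replaced by the
   meta-level proposition [N] at a larger context. *)
Definition splits (P : tv) (N : list form -> Prop) : Prop :=
  (forall w w', incl w w' -> N w -> N w') /\
  (forall w C, (w ⊩ P) -> (forall w', incl w w' -> N w' -> w' ⊩ C) -> w ⊩ C).

Lemma splits_self P : splits P (fun w => w ⊩ P).
Proof.
  split.
  - intros w w' Hw. now apply up_world.
  - intros w C HP HC. apply HC; auto using incl_refl.
Qed.

Lemma splits_and P Q N M :
  splits P N -> splits Q M -> splits (P ∧ Q) (fun w => N w /\ M w).
Proof.
  intros [N1 N2] [M1 M2]. split.
  - intros w w' Hw []. eauto.
  - intros w C HPQ HC. destruct (and_e _ _ _ HPQ) as [HP HQ].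
    apply (N2 _ _ HP). intros w1 H1 HN. apply (M2 w1).
    + now apply (up_world w).
    + intros w2 H2 HM. apply HC; eauto using incl_tran.
Qed.

Lemma splits_or P Q N M :
  splits P N -> splits Q M -> splits (P ∨ Q) (fun w => N w \/ M w).
Proof.
  intros [N1 N2] [M1 M2]. split.
  - intros w w' Hw []; eauto.
  - intros w C HPQ HC. apply (or_e _ _ _ _ HPQ); intros w1 H1 H.
    + apply (N2 _ _ H). intros w2 H2 HN. apply HC; eauto using incl_tran.
    + apply (M2 _ _ H). intros w2 H2 HN. apply HC; eauto using incl_tran.
Qed.

Lemma splits_ex P N :
  (forall x, splits (P x) (N x)) -> splits (tex P) (fun w => exists x, N x w).
Proof.
  intros HN. split.
  - intros w w' Hw [x Hx]. exists x. destruct (HN x) as [N1 _]. eauto.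
  - intros w C HP HC. apply (ex_e _ _ _ HP). intros x w1 H1 H.
    destruct (HN x) as [_ N2]. apply (N2 _ _ H). intros w2 H2 Hx.
    apply HC; eauto using incl_tran.
Qed.

(** Counterpart of [splits] for connectives that can be read off at the present context: nothing is
    enlarged, so it serves to apply a hypothesis rather than to take it apart by cases. *)
Definition opens (P : tv) (N : list form -> Prop) : Prop := forall w, (w ⊩ P) -> N w.

Lemma opens_self P : opens P (fun w => w ⊩ P).
Proof. intros w H. exact H. Qed.
Lemma opens_all P N :
  (forall x, opens (P x) (N x)) -> opens (tall P) (fun w => forall x, N x w).
Proof. intros HN w H x. apply HN, (all_e _ _ H). Qed.
Lemma opens_imp P Q N : opens Q N -> opens (P ⇒ Q) (fun w => (w ⊩ P) -> N w).
Proof. intros HN w H HP. apply HN, (mp _ _ _ H HP). Qed.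
Lemma opens_and P Q N M :
  opens P N -> opens Q M -> opens (P ∧ Q) (fun w => N w /\ M w).
Proof. intros HN HM w H. destruct (and_e _ _ _ H). split; auto. Qed.
Lemma opens_iff P Q :
  opens (P ⇔ Q) (fun w => ((w ⊩ P) -> (w ⊩ Q)) /\ ((w ⊩ Q) -> (w ⊩ P))).
Proof. intros w. apply iff_e. Qed.

Ltac head P :=
  lazymatch P with
  | tall _ => P | tex _ => P | timp _ _ => P | tiff _ _ => P | tand _ _ => P
  | tor _ _ => P | tnot ?Q => constr:(timp Q tbot) | tmem _ _ => P | teq _ _ => P | tbot => P
  | _ => let P' := eval red in P in head P'
  end.

Ltac beta P := let P' := eval cbv beta in P in P'.

Ltac lift_all le :=
  lazymatch type of le with
  | incl ?w ?w' =>
      repeat match goal with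
        | h : holds w _ |- _ => apply (up_world _ _ _ le) in h
        end;
      clear le; try clear w
  end.

Ltac solve_splits :=
  lazymatch goal with
  | |- splits (tex _) _ => eapply splits_ex; intro; solve_splits
  | |- splits (tand _ _) _ => eapply splits_and; solve_splits
  | |- splits (tor _ _) _ => eapply splits_or; solve_splits
  | |- splits ?P _ => lazymatch P with
      | (fun _ => _) _ => let P' := beta P in change_no_check (splits P' _) ; solve_splits
      | _ => eapply splits_self end
  end.

Tactic Notation "fdestruct" constr(h) "as" simple_intropattern(p) :=
  let n := fresh "N" in
  let le := fresh "le" in
  lazymatch type of h with
  | holds ?w ?P =>
      let P' := head P in
      let N := open_constr:(_ : list form -> Prop) in
      let S := fresh "S" in
      assert (S : splits P' N) by solve_splits;
      let w' := fresh "w" in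
      apply (proj2 S w _ h); clear S; try clear h; intros w' le n;
      cbv beta in n; lift_all le; destruct n as p
  end.

Ltac solve_opens :=
  lazymatch goal with
  | |- opens (tall _) _ => eapply opens_all; intro; solve_opens
  | |- opens (timp _ _) _ => eapply opens_imp; solve_opens
  | |- opens (tnot ?P) _ => change (opens (timp P tbot) _); eapply opens_imp; solve_opens
  | |- opens (tand _ _) _ => eapply opens_and; solve_opens
  | |- opens (tiff _ _) _ => eapply opens_iff
  | |- opens ?P _ => lazymatch P with
      | (fun _ => _) _ => let P' := beta P in change_no_check (opens P' _) ; solve_opens
      | _ => eapply opens_self end
  end.

Tactic Notation "fopen" constr(h) "as" ident(n) :=
  lazymatch type of h with
  | holds ?w ?P =>
      let P' := head P in
      let N := open_constr:(_ : list form -> Prop) in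
      let S := fresh "S" in
      assert (S : opens P' N) by solve_opens;
      pose proof (S w h) as n; clear S; cbv beta in n
  end.

Tactic Notation "fapply" constr(h) :=
  let n := fresh "N" in fopen h as n; eapply n; clear n.

Ltac intro_prefix w P :=
  lazymatch P with
  | tall ?F =>
      apply (all_i w F); let x := fresh in intro x;
      let Q := eval cbv beta in (F x) in
      change (holds w Q); intro_prefix w Q; revert x
  | timp ?A ?B =>
      apply (imp_i w A B);
      let w' := fresh "w" in let le := fresh in let h := fresh in
      intros w' le h; lift_all le; intro_prefix w' B; revert h
  | tnot ?A => intro_prefix w (timp A tbot)
  | _ => idtac
  end.

(* Turns a goal [w ⊩ ∀ x, P ⇒ Q] into [forall x, w' ⊩ P -> w' ⊩ Q]. *)
Ltac intro_all :=
  lazymatch goal with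
  | |- holds ?w ?P => let P' := head P in intro_prefix w P'
  | _ => idtac
  end.

Tactic Notation "fintros" simple_intropattern_list(p) := intro_all; intros p.

Ltac fsplit :=
  lazymatch goal with
  | |- holds ?w ?P =>
      let P' := head P in
      lazymatch P' with
      | tand ?A ?B => apply (and_i w A B)
      | tiff ?A ?B => apply (iff_i w A B)
      end
  end.
Tactic Notation "fexists" constr(x) :=
  lazymatch goal with
  | |- holds ?w ?P => let P' := head P in
      lazymatch P' with tex ?F => apply (ex_i w F x); cbv beta end
  end.
Ltac fleft :=
  lazymatch goal with
  | |- holds ?w ?P => let P' := head P in
      lazymatch P' with tor ?A ?B => apply (or_l w A B) end
  end.
Ltac fright :=
  lazymatch goal with
  | |- holds ?w ?P => let P' := head P in
      lazymatch P' with tor ?A ?B => apply (or_r w A B) end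
  end.

(** * Quoting truth values as formulas, stratification and rewriting *)

Ltac index_of x e :=
  lazymatch e with
  | x :: _ => constr:(0)
  | _ :: ?e' => let n := index_of x e' in constr:(S n)
  end.

Ltac quote_tv e t :=
  lazymatch t with
  | tmem ?x ?y => let i := index_of x e in let j := index_of y e in constr:(Mem i j)
  | teq ?x ?y => let i := index_of x e in let j := index_of y e in constr:(Eq i j)
  | tbot => constr:(Bot)
  | tand ?P ?Q => let A := quote_tv e P in let B := quote_tv e Q in constr:(And A B)
  | tiff ?P ?Q => let A := quote_tv e P in let B := quote_tv e Q in constr:(Iff A B)
  | tor ?P ?Q => let A := quote_tv e P in let B := quote_tv e Q in constr:(Or A B)
  | timp ?P ?Q => let A := quote_tv e P in let B := quote_tv e Q in constr:(Imp A B)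
  | tall ?F => let A := quote_fun e F in constr:(All A)
  | tex ?F => let A := quote_fun e F in constr:(Ex A)
  end
with quote_fun e F :=
  let x := fresh in
  let r := constr:(fun x : nat => ltac:(
    let t := eval cbv beta in (F x) in
    let A := quote_tv constr:(x :: e) t in exact A)) in
  lazymatch r with fun _ => ?A => A end.

Ltac vars_of t l :=
  match goal with
  | x : nat |- _ =>
      let _ := lazymatch l with context [x] => fail | _ => I end in
      let _ := lazymatch t with context [x] => I end in
      vars_of t constr:(x :: l)
  | _ => l
  end.

Ltac vars t := vars_of t (@nil nat).

Ltac unfold_tv t :=
  eval cbv beta delta -[tall tex timp tiff tand tor tmem teq tbot] in t.

Ltac level_env l :=
  lazymatch l with
  | nil => open_constr:(fun _ : nat => 0)
  | cons _ ?l' => let s := level_env l' in open_constr:(scons _ s)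
  end.

(** Each side is checked once; unfolding [Iff] would repeat both sides and double the work at every
    nesting. *)
Lemma stratified_by_iff s A B :
  stratified_by s A -> stratified_by s B -> stratified_by s (Iff A B).
Proof. cbn; auto. Qed.

Ltac solve_levels :=
  lazymatch goal with
  | |- stratified_by _ (Iff _ _) => apply stratified_by_iff; solve_levels
  | |- stratified_by _ (Mem _ _) => cbn; reflexivity
  | |- stratified_by _ (Eq _ _) => cbn; reflexivity
  | |- stratified_by _ Bot => exact I
  | |- stratified_by _ (All _) => eexists; solve_levels
  | |- stratified_by _ (Ex _) => eexists; solve_levels
  | |- stratified_by _ _ => split; solve_levels
  end.

(** Levels start as existential variables, and unification turns each membership into a successor.
    Levels still open at the end are arbitrary and become 0. The extra head of [0 :: l] only
    reserves a place for the element of the abstract. *)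
Ltac solve_stratified l :=
  unshelve (let s := level_env constr:(0 :: l) in
            exists s; solve_levels); exact 0.

(* The leading [idtac] delays the match when [comprehend] is passed as an
   argument to [fhave]. *)
Ltac comprehend :=
  idtac;
  lazymatch goal with
  | |- holds ?w ?G =>
      let G' := unfold_tv G in
      lazymatch G' with
      | tex (fun y => tall (fun x => tiff (tmem x y) (@?P x))) =>
          let l := vars P in
          let A := quote_fun l P in
          let H := fresh in
          assert (H : stratified A) by solve_stratified l;
          exact (comprehension A l w H)
      end
  end.

Lemma mem_eq_l w x y a : (w ⊩ x ≡ y) -> (w ⊩ x ∈ a) -> w ⊩ y ∈ a.
Proof. exact (transport (Mem 0 1) [a] x y w). Qed.
Lemma mem_eq_r w x y a : (w ⊩ x ≡ y) -> (w ⊩ a ∈ x) -> w ⊩ a ∈ y.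
Proof. exact (transport (Mem 1 0) [a] x y w). Qed.
Lemma eq_sym_tv w x y : (w ⊩ x ≡ y) -> w ⊩ y ≡ x.
Proof. intros H. exact (transport (Eq 0 1) [x] x y w H (eq_refl_tv x w)). Qed.
Lemma eq_trans_tv w x y z : (w ⊩ x ≡ y) -> (w ⊩ y ≡ z) -> w ⊩ x ≡ z.
Proof. intros H1 H2. exact (transport (Eq 1 0) [x] y z w H2 H1). Qed.

Ltac transport_in e h :=
  lazymatch type of e with
  | holds ?w (teq ?x ?y) =>
      lazymatch type of h with
      | holds w (tmem x ?a) => apply (mem_eq_l w x y a e) in h
      | holds w (tmem ?a x) => apply (mem_eq_r w x y a e) in h
      | holds w ?P =>
          lazymatch eval pattern x in P with
          | ?F _ =>
              let F' := unfold_tv F in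
              let l := vars F' in
              let A := quote_fun l F' in
              let P' := eval cbv beta in (F y) in
              let h' := fresh in
              assert (h' : holds w P') by exact (transport A l x y w e h);
              clear h; rename h' into h
          end
      end
  end.

Ltac fsubst e :=
  lazymatch type of e with
  | holds ?w (teq ?x ?y) =>
      repeat match goal with
        | h : holds w ?P |- _ =>
            lazymatch h with e => fail | _ => idtac end;
            lazymatch P with context [x] => idtac end;
            transport_in e h
        end;
      lazymatch goal with
      | |- holds w ?P => lazymatch P with context [x] =>
          let g := fresh in let P' := eval pattern x in P in
          lazymatch P' with ?F _ =>
            let Q := eval cbv beta in (F y) in
            enough (g : holds w Q);
            [ let F' := unfold_tv F in
              let l := vars F' in
              let A := quote_fun l F' in
              exact (transport A l y x w (eq_sym_tv w x y e) g) | ] end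
          | _ => idtac end
      end; clear e; try clear x
  end.

Tactic Notation "fhave" ident(E) ":" constr(P) :=
  lazymatch goal with |- holds ?w _ => assert (E : holds w P) end.
Tactic Notation "fhave" ident(E) ":" constr(P) "by" tactic3(t) :=
  lazymatch goal with |- holds ?w _ => assert (E : holds w P) by t end.

Tactic Notation "fobtain" uconstr(t) "as" simple_intropattern(p) :=
  lazymatch goal with
  | |- holds ?w _ =>
      let H := fresh in
      pose proof ((t) : holds w _) as H; fdestruct H as p
  end.

Tactic Notation "fapply" constr(H) "in" hyp(m) :=
  let K := fresh "K" in fopen H as K; apply K in m; clear K.

Ltac not_known w P :=
  lazymatch goal with h : holds w P |- _ => fail | _ => idtac end.
Ltac add_new w P t := not_known w P; pose proof (t : holds w P).

Ltac distinct x y := lazymatch x with y => fail | _ => idtac end.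

Ltac eq_close n :=
  first
    [ assumption
    | apply eq_refl_tv
    | apply eq_sym_tv; assumption
    | lazymatch n with
      | S ?m =>
          match goal with
          | h : holds ?w (teq ?x ?y) |- holds ?w (teq ?x ?z) =>
              apply (eq_trans_tv w x y z h); clear h; eq_close m
          | h : holds ?w (teq ?y ?x) |- holds ?w (teq ?x ?z) =>
              apply (eq_trans_tv w x y z (eq_sym_tv w y x h)); clear h; eq_close m
          end
      end ].

(** The guards [not_known] keep a fact from being added twice, and a disjunction from being split
    when one side is already known. *)
Ltac chase_step :=
  match goal with
  | h : holds ?w tbot |- holds ?w _ => exact (bot_e _ _ h)
  | h : holds ?w ?P |- holds ?w ?P => exact h
  | |- holds ?w (teq ?x ?x) => exact (eq_refl_tv x w)
  | h : holds ?w (tnot ?P), h' : holds ?w ?P |- _ => exact (bot_e _ _ (mp _ _ _ h h'))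
  | h : holds ?w (timp ?P tbot), h' : holds ?w ?P |- _ => exact (bot_e _ _ (mp _ _ _ h h'))
  | |- holds ?w (tall _) => intro_all; intros
  | |- holds ?w (timp _ _) => intro_all; intros
  | |- holds ?w (tnot _) => intro_all; intros
  | |- holds ?w (tand _ _) => fsplit
  | |- holds ?w (tiff _ _) => fsplit
  | h : holds ?w (tex ?P) |- holds ?w _ =>
      let w' := fresh "w" in let le := fresh "le" in let k := fresh in let x := fresh in
      apply (ex_e w P _ h); clear h; intros x w' le k; cbv beta in k; lift_all le
  | h : holds ?w (tand ?P ?Q) |- _ => add_new w P (proj1 (and_e w P Q h))
  | h : holds ?w (tand ?P ?Q) |- _ => add_new w Q (proj2 (and_e w P Q h))
  | h : holds ?w (teq ?x ?y), k : holds ?w (tmem ?x ?a) |- _ =>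
      distinct x y; add_new w constr:(tmem y a) (mem_eq_l w x y a h k)
  | h : holds ?w (teq ?x ?y), k : holds ?w (tmem ?a ?x) |- _ =>
      distinct x y; add_new w constr:(tmem a y) (mem_eq_r w x y a h k)
  | h : holds ?w (tall (fun t => tiff (tmem t ?v) (@?P t))), m : holds ?w (tmem ?x ?v) |- _ =>
      let P' := eval cbv beta in (P x) in
      add_new w P' (iff_l w _ _ (all_e w _ h x) m)
  | h : holds ?w (tall (fun t => timp (tmem t ?v) (@?P t))), m : holds ?w (tmem ?x ?v) |- _ =>
      let P' := eval cbv beta in (P x) in
      add_new w P' (mp w _ _ (all_e w _ h x) m)
  | h : holds ?w (timp ?P ?Q), h' : holds ?w ?P |- _ => add_new w Q (mp w _ _ h h')
  | h : holds ?w (teq ?x ?y) |- holds ?w (tmem ?x ?a) =>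
      distinct x y; apply (mem_eq_l w y x a (eq_sym_tv _ _ _ h))
  | h : holds ?w (teq ?x ?y) |- holds ?w (tmem ?a ?x) =>
      distinct x y; apply (mem_eq_r w y x a (eq_sym_tv _ _ _ h))
  | |- holds _ (teq _ _) => eq_close 4
  | h : holds ?w (tor ?P ?Q) |- holds ?w _ =>
      not_known w P; not_known w Q;
      let w' := fresh "w" in let le := fresh "le" in let k := fresh in
      apply (or_e w P Q _ h); intros w' le k; lift_all le
  | h : holds ?w (tall (fun t => tiff (tmem t ?v) (@?P t))) |- holds ?w (tmem ?x ?v) =>
      apply (iff_r _ _ _ (all_e _ _ h x)); cbv beta
  end.

(* Saturates the hypotheses; [n] bounds the number of non-invertible steps. *)
Ltac chase n :=
  repeat chase_step;
  try lazymatch n with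
  | S ?m =>
    match goal with
    | |- holds ?w (tor _ _) => solve [fleft; chase m]
    | |- holds ?w (tor _ _) => solve [fright; chase m]
    | h : holds ?w (tnot ?P) |- holds ?w _ =>
        solve [apply bot_e; apply (mp _ _ _ h); chase m]
    | h : holds ?w (timp ?P tbot) |- holds ?w _ =>
        solve [apply bot_e; apply (mp _ _ _ h); chase m]
    | h : holds ?w (tall (fun t => timp (@?P t) (tmem t ?v))) |- holds ?w (tmem ?x ?v) =>
        solve [apply (fun k => mp _ _ _ (all_e _ _ h x) k); cbv beta; chase m]
    end
  end.

(** * Finite Frege cardinals *)

Definition Sub a b := ∀ t, t ∈ a ⇒ t ∈ b.
Definition Sep a b := Sub a b ∧ ∀ t, t ∈ b ⇒ t ∈ a ∨ t ∉ a.
Definition Adj v u c := ∀ t, t ∈ v ⇔ t ∈ u ∨ t ≡ c.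
Definition Del v u c := ∀ t, t ∈ v ⇔ t ∈ u ∧ ¬ t ≡ c.
Definition Empty u := ∀ t, t ∈ u ⇔ tbot.
Definition Zero z := ∀ u, u ∈ z ⇔ Empty u.
Definition in_succ v x := ∃ u c, u ∈ x ∧ c ∉ u ∧ Adj v u c.
Definition Succ y x := ∀ v, v ∈ y ⇔ in_succ v x.
(** Like its companions, this spells out what the set abstracts of the statement become under [tMem]
    and [tEq], so that the final theorem follows by conversion. *)
Definition FregeNum n := ∀ w,
  (∃ z, Zero z ∧ z ∈ w)
  ∧ (∀ x, x ∈ w ∧ (∃ u, in_succ u x) ⇒ ∃ y, Succ y x ∧ y ∈ w) ⇒ n ∈ w.

Ltac unfold_sets := unfold Sep, Sub, Adj, Del, Empty in *.
Ltac set_solver := unfold_sets; chase 2.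

Lemma ext {w x y} : (w ⊩ ∀ t, t ∈ x ⇔ t ∈ y) -> w ⊩ x ≡ y.
Proof. apply extensionality. Qed.

Lemma same_ext {w x y P} :
  (w ⊩ ∀ t, t ∈ x ⇔ P t) -> (w ⊩ ∀ t, t ∈ y ⇔ P t) -> w ⊩ x ≡ y.
Proof. intros Hx Hy. apply ext. chase 1. Qed.

Lemma Adj_ex {w} u c : w ⊩ ∃ v, Adj v u c.
Proof. comprehend. Qed.
Lemma Del_ex {w} u c : w ⊩ ∃ v, Del v u c.
Proof. comprehend. Qed.
Lemma Empty_ex {w} : w ⊩ ∃ v, Empty v.
Proof. comprehend. Qed.
Lemma Zero_ex {w} : w ⊩ ∃ v, Zero v.
Proof. comprehend. Qed.
Lemma Succ_ex {w} x : w ⊩ ∃ v, Succ v x.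
Proof. comprehend. Qed.

Lemma FregeNum_zero {w z} : (w ⊩ Zero z) -> w ⊩ FregeNum z.
Proof.
  intros Hz. fintros v H. fdestruct H as [[z' [Hz' Hv]] _].
  fhave E : (z' ≡ z) by (eapply same_ext; eassumption).
  set_solver.
Qed.

Lemma FregeNum_succ {w x y u} :
  (w ⊩ FregeNum x) -> (w ⊩ in_succ u x) -> (w ⊩ Succ y x) -> w ⊩ FregeNum y.
Proof.
  intros Hx Hu Hy. fintros v H. fhave Hxv : (x ∈ v) by (fapply Hx; exact H).
  apply and_e in H. destruct H as [_ H].
  fhave K : (∃ y, Succ y x ∧ y ∈ v).
  { fapply H. fsplit; [|fexists u]; assumption. }
  fdestruct K as [y' [Hy' Hv]].
  fhave E : (y' ≡ y) by exact (same_ext Hy' Hy).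
  set_solver.
Qed.

Lemma FregeNum_ind {w P} :
  (w ⊩ ∃ v, ∀ x, x ∈ v ⇔ P x) ->
  (w ⊩ ∀ z, Zero z ⇒ P z) ->
  (w ⊩ ∀ x y u, FregeNum x ⇒ P x ⇒ in_succ u x ⇒ Succ y x ⇒ P y) ->
  forall n, (w ⊩ FregeNum n) -> w ⊩ P n.
Proof.
  intros HP H0 HS n Hn. fdestruct HP as [v Hv].
  (* Cutting down to the finite cardinals, again a stratified class, makes [FregeNum x] available in
     the induction step. *)
  fhave HV : (∃ y, ∀ x, x ∈ y ⇔ FregeNum x ∧ x ∈ v) by comprehend.
  fdestruct HV as [V HV].
  fhave K : (n ∈ V).
  { fapply Hn. fsplit.
    - fobtain Zero_ex as [z Hz]. fexists z. fsplit; [assumption|].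
      fapply HV. fsplit; [now apply FregeNum_zero|]. fapply Hv. now fapply H0.
    - fintros x H. fdestruct H as [Hx [u Hu]]. fobtain (Succ_ex x) as [y Hy]. fexists y.
      fsplit; [assumption|].
      fopen HV as K. apply K in Hx. fdestruct Hx as [Hx Hxv]. clear K.
      fapply HV. fsplit; [eapply FregeNum_succ; eassumption|].
      fopen Hv as K. apply K. apply K in Hxv. clear K.
      fapply HS; [exact Hx|exact Hxv|exact Hu|exact Hy]. }
  fopen HV as K'. apply K' in K. clear K'. fdestruct K as [_ K]. fopen Hv as K'. now apply K'.
Qed.

Ltac frege_ind z Hz :=
  lazymatch goal with
  | |- holds ?w ?G =>
      lazymatch eval pattern z in G with
      | ?P _ => apply (@FregeNum_ind w P); [comprehend | clear z Hz | clear z Hz | exact Hz]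
      end
  end.

Lemma not_in_empty {w u c} (P : tv) : (w ⊩ Empty u) -> (w ⊩ c ∈ u) -> w ⊩ P.
Proof. intros. set_solver. Qed.

Lemma zero_not_succ {w z x v} (P : tv) :
  (w ⊩ Zero z) -> (w ⊩ v ∈ z) -> (w ⊩ in_succ v x) -> w ⊩ P.
Proof.
  intros Hz Hv H. fdestruct H as [u [c [_ [_ H]]]].
  fhave Hc : (c ∈ v) by set_solver.
  fapply Hz in Hv. exact (not_in_empty P Hv Hc).
Qed.

Lemma FregeNum_cases {w n} : (w ⊩ FregeNum n) ->
  w ⊩ Zero n ∨ ∃ m v, FregeNum m ∧ in_succ v m ∧ Succ n m.
Proof.
  intros Hn. frege_ind n Hn.
  - fintros z Hz. fleft. exact Hz.
  - fintros z y u Hz _ Hu Hy. fright. fexists z. fexists u. repeat fsplit; assumption.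
Qed.

Lemma FregeNum_inhabited {w n} : (w ⊩ FregeNum n) -> w ⊩ ∃ a, a ∈ n.
Proof.
  intros Hn. fobtain (FregeNum_cases Hn) as [Hz|[m [v [Hm [Hv Hs]]]]].
  - fobtain Empty_ex as [e He]. fexists e. now fapply Hz.
  - fexists v. now fapply Hs.
Qed.

(** Any element may play the part of the one added last. Membership of [c] in [a] already is a
    disjunction, either [c] is the last element [d] or it lies in the rest [v], so equality need not
    be decidable. In the second case [c] is deleted from [v] and [d] is added again. *)
Lemma FregeNum_remove {w z} : (w ⊩ FregeNum z) ->
  w ⊩ ∀ a c r, in_succ a z ⇒ c ∈ a ⇒ Del r a c ⇒ r ∈ z.
Proof.
  intros Hz. frege_ind z Hz.
  - fintros z Hz. fintros a c r Ha Hc Hr. fdestruct Ha as [v [d [Hv [Hd Ha]]]].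
    fhave E : (r ≡ v).
    { fapply Hz in Hv. apply ext. set_solver. }
    fsubst E. assumption.
  - fintros z y u Hz IH _ Hy. fintros a c r Ha Hc Hr. fdestruct Ha as [v [d [Hv [Hd Ha]]]].
    pose proof Hc as Hc'. fapply Ha in Hc'. fdestruct Hc' as [Hcv|E].
    + fobtain (Del_ex v c) as [q Hq].
      fapply Hy. fexists q. fexists d. repeat fsplit.
      * fapply IH; [|exact Hcv|exact Hq]. fapply Hy in Hv. exact Hv.
      * set_solver.
      * set_solver.
    + fhave E' : (r ≡ v). { apply ext. unfold_sets.  chase 2. }
      fsubst E'. assumption.
Qed.

(** The same element is deleted from the common member on both sides, which gives a common member of
    the predecessors. *)
Lemma FregeNum_uniq {w x} : (w ⊩ FregeNum x) -> w ⊩ ∀ y a, FregeNum y ⇒ a ∈ x ⇒ a ∈ y ⇒ x ≡ y.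
Proof.
  intros Hx. frege_ind x Hx.
  - fintros z Hz. fintros y a Hy Haz Hay. fobtain (FregeNum_cases Hy) as [Hy0|[m [v [_ [_ Hs]]]]].
    + exact (same_ext Hz Hy0).
    + fapply Hs in Hay. exact (zero_not_succ _ Hz Haz Hay).
  - fintros x x' u Hx IH _ Hx'. fintros y a Hy Hax Hay. fapply Hx' in Hax.
    fobtain (FregeNum_cases Hy) as [Hy0|[m [v [Hm [_ Hs]]]]].
    + exact (zero_not_succ _ Hy0 Hay Hax).
    + fapply Hs in Hay. fdestruct Hax as [u0 [c [Hu0 [Hc Ha]]]].
      fhave E : (x ≡ m).
      { fapply IH; [exact Hm|exact Hu0|].
        fapply (FregeNum_remove Hm); [exact Hay| |]; set_solver. }
      fsubst E. exact (same_ext Hx' Hs).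
Qed.

(** A pigeonhole principle without bijections: deleting the last element of [a] from both sets leads
    to the predecessor. *)
Lemma no_succ_subset {w x} : (w ⊩ FregeNum x) -> w ⊩ ∀ a b, in_succ a x ⇒ b ∈ x ⇒ Sub a b ⇒ tbot.
Proof.
  intros Hx. frege_ind x Hx.
  - fintros z Hz. fintros a b Ha Hb Hab. fdestruct Ha as [u [c [_ [_ Ha]]]].
    fhave Hc : (c ∈ b).
    { fapply Hab. set_solver. }
    fapply Hz in Hb. exact (not_in_empty _ Hb Hc).
  - fintros x x' u Hx IH _ Hx'. fintros a b Ha Hb Hab. fdestruct Ha as [u0 [c [Hu [Hc Ha]]]].
    fapply Hx' in Hu. fapply Hx' in Hb. fobtain (Del_ex b c) as [r Hr].
    fhave Hcb : (c ∈ b).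
    { fapply Hab. set_solver. }
    fapply IH; [exact Hu| |].
    + fapply (FregeNum_remove Hx); [exact Hb|exact Hcb|exact Hr].
    + set_solver.
Qed.

Lemma Sep_remove {w a b u c r} : (w ⊩ Sep a b) -> (w ⊩ Adj b u c) -> (w ⊩ c ∉ u) ->
  (w ⊩ c ∈ a) -> (w ⊩ Del r a c) -> w ⊩ Sep r u.
Proof.
  intros Hab Hb Hc Hca Hr. fsplit; [set_solver|].
  fintros t Ht. fhave Htb : (t ∈ b) by set_solver. set_solver.
Qed.

Lemma Sep_skip {w a b u c} : (w ⊩ Sep a b) -> (w ⊩ Adj b u c) ->
  (w ⊩ c ∉ a) -> w ⊩ Sep a u.
Proof.
  intros Hab Hb Hca. fsplit; [set_solver|].
  fintros t Ht. fhave Htb : (t ∈ b) by set_solver. set_solver.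
Qed.

Lemma Sep_Adj {w a u c b} : (w ⊩ Sep a u) -> (w ⊩ c ∉ u) -> (w ⊩ Adj b u c) -> w ⊩ Sep a b.
Proof. intros Ha Hc Hb. set_solver. Qed.

Lemma Sep_Adj_both {w a u c b b'} : (w ⊩ Sep a u) -> (w ⊩ c ∉ u) ->
  (w ⊩ Adj b u c) -> (w ⊩ Adj b' a c) -> w ⊩ Sep b' b.
Proof. intros Ha Hc Hb Hb'. set_solver. Qed.

(** A search through the finite set [b]: separability decides each element, and the first one
    outside [a] is the witness [e]. *)
Lemma Sep_dec {w y} : (w ⊩ FregeNum y) ->
  w ⊩ ∀ b a, b ∈ y ⇒ Sep a b ⇒ a ≡ b ∨ ∃ e, e ∈ b ∧ e ∉ a.
Proof.
  intros Hy. frege_ind y Hy.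
  - fintros z Hz. fintros b a Hb Hab. fapply Hz in Hb. fleft. apply ext. set_solver.
  - fintros y y' u0 Hy IH _ Hy'. fintros b a Hb Hab. fapply Hy' in Hb.
    fdestruct Hb as [u [c [Hu [Hc Hb]]]].
    fhave Hcb : (c ∈ b) by set_solver.
    pose proof Hab as Hab'. fdestruct Hab' as [Hsub Hsep].
    fapply Hsep in Hcb. fdestruct Hcb as [Hca|Hca].
    + fobtain (Del_ex a c) as [a' Ha'].
      fhave Hs : (a' ≡ u ∨ ∃ e, e ∈ u ∧ e ∉ a').
      { fapply IH; [exact Hu|]. exact (Sep_remove Hab Hb Hc Hca Ha'). }
      fdestruct Hs as [E|[e [He Hea]]].
      * fleft. fsubst E. apply ext. set_solver.
      * fright. fexists e. set_solver.
    + fright. fexists c. set_solver.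
Qed.

(** Makes [Le] independent of the chosen member of the larger cardinal. The cardinal [z] is
    quantified inside the induction formula because it drops to its predecessor when the deleted
    element lies in [a]. *)
Lemma Sep_move {w x} : (w ⊩ FregeNum x) -> w ⊩ ∀ z a b u,
  FregeNum z ⇒ a ∈ z ⇒ b ∈ x ⇒ Sep a b ⇒ u ∈ x ⇒ ∃ a', a' ∈ z ∧ Sep a' u.
Proof.
  intros Hx. frege_ind x Hx.
  - fintros x Hx. fintros z a b u Hz Ha Hb Hab Hu. fexists a. fsplit; [exact Ha|].
    fapply Hx in Hb. fapply Hx in Hu. set_solver.
  - fintros x x' v Hx IH _ Hx'. fintros z a b u Hz Ha Hb Hab Hu.
    fapply Hx' in Hb. fapply Hx' in Hu.
    fdestruct Hb as [b0 [d [Hb0 [Hd Hb]]]]. fdestruct Hu as [u0 [e [Hu0 [He Hu]]]].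
    fhave Hdb : (d ∈ b) by set_solver.
    pose proof Hab as Hab'. fdestruct Hab' as [Hsub Hsep].
    fapply Hsep in Hdb. fdestruct Hdb as [Hda|Hda].
    + fobtain (FregeNum_cases Hz) as [Hz0|[m [w [Hm [_ Hs]]]]].
      { fapply Hz0 in Ha. exact (not_in_empty _ Ha Hda). }
      fapply Hs in Ha. fobtain (Del_ex a d) as [a0 Ha0].
      fhave Ha0m : (a0 ∈ m).
      { fapply (FregeNum_remove Hm); [exact Ha|exact Hda|exact Ha0]. }
      fhave K : (∃ a', a' ∈ m ∧ Sep a' u0).
      { fapply IH; [exact Hm|exact Ha0m|exact Hb0| |exact Hu0].
        exact (Sep_remove Hab Hb Hd Hda Ha0). }
      fdestruct K as [a1 [Ha1 Hs1]]. fobtain (Adj_ex a1 e) as [a2 Ha2]. fexists a2. fsplit.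
      * fapply Hs. fexists a1. fexists e. repeat fsplit; [exact Ha1| |exact Ha2]. set_solver.
      * exact (Sep_Adj_both Hs1 He Hu Ha2).
    + fhave K : (∃ a', a' ∈ z ∧ Sep a' u0).
      { fapply IH; [exact Hz|exact Ha|exact Hb0| |exact Hu0].
        exact (Sep_skip Hab Hb Hda). }
      fdestruct K as [a1 [Ha1 Hs1]]. fexists a1. fsplit; [exact Ha1|].
      exact (Sep_Adj Hs1 He Hu).
Qed.

(** * The order of the Frege cardinals *)

Definition Le x y :=
  ∃ a b, a ∈ x ∧ b ∈ y ∧ Sub a b ∧ ∀ t, t ∈ b ⇔ t ∈ a ∨ t ∈ b ∧ t ∉ a.
Definition Lt x y := Le x y ∧ ¬ x ≡ y.

Lemma Le_i {w x y a b} : (w ⊩ a ∈ x) -> (w ⊩ b ∈ y) -> (w ⊩ Sep a b) -> w ⊩ Le x y.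
Proof.
  intros Ha Hb Hab. fexists a. fexists b. repeat fsplit; try assumption; set_solver.
Qed.

Lemma Le_e {w x y} : (w ⊩ Le x y) -> w ⊩ ∃ a b, a ∈ x ∧ b ∈ y ∧ Sep a b.
Proof.
  intros H. fdestruct H as [a [b [Ha [Hb [Hab Hd]]]]]. fexists a. fexists b.
  repeat fsplit; try assumption. fintros t Ht. fapply Hd in Ht. fdestruct Ht as [Ht|[_ Ht]].
  - fleft. exact Ht.
  - fright. exact Ht.
Qed.

(** Deleting [e] from [b] gives a member of the predecessor that still includes [a], against
    [no_succ_subset]. *)
Lemma no_proper {w x a b e} (P : tv) :
  (w ⊩ FregeNum x) -> (w ⊩ a ∈ x) -> (w ⊩ b ∈ x) -> (w ⊩ Sub a b) ->
  (w ⊩ e ∈ b) -> (w ⊩ e ∉ a) -> w ⊩ P.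
Proof.
  intros Hx Ha Hb Hab Heb Hea. apply bot_e.
  fobtain (FregeNum_cases Hx) as [H0|[m [v [Hm [_ Hs]]]]].
  - fapply H0 in Hb. exact (not_in_empty _ Hb Heb).
  - fapply Hs in Ha. fapply Hs in Hb. fobtain (Del_ex b e) as [r Hr].
    fhave Hrm : (r ∈ m).
    { fapply (FregeNum_remove Hm); [exact Hb|exact Heb|exact Hr]. }
    fapply (no_succ_subset Hm); [exact Ha|exact Hrm|]. set_solver.
Qed.

Lemma Lt_zero {w x z} (P : tv) : (w ⊩ Zero x) -> (w ⊩ FregeNum z) -> (w ⊩ Lt z x) -> w ⊩ P.
Proof.
  intros Hx Hz H. apply bot_e. fdestruct H as [H Hn]. fobtain (Le_e H) as [a [b [Ha [Hb Hab]]]].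
  fapply Hn. fapply (FregeNum_uniq Hz); [now apply FregeNum_zero|exact Ha|].
  fapply Hx in Hb. fapply Hx. set_solver.
Qed.

Lemma Sep_Del {w a b r e} : (w ⊩ Sep a b) -> (w ⊩ e ∉ a) -> (w ⊩ Del r b e) -> w ⊩ Sep a r.
Proof. intros Hab He Hr. set_solver. Qed.

Lemma Sep_Adj_self {w u c b} : (w ⊩ c ∉ u) -> (w ⊩ Adj b u c) -> w ⊩ Sep u b.
Proof. intros Hc Hb. set_solver. Qed.

(** [Sep_dec] is used twice: on [b], where equality would give z = y, and then on [b] without the
    point [e] found outside [a]. Together with [Lt_succ_i], [Lt_zero] and irreflexivity this is all
    that is used about the order later on. *)
Lemma Lt_succ_e {w x y z v} :
  (w ⊩ FregeNum x) -> (w ⊩ in_succ v x) -> (w ⊩ Succ y x) -> (w ⊩ FregeNum z) ->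
  (w ⊩ Lt z y) -> w ⊩ Lt z x ∨ z ≡ x.
Proof.
  intros Hx Hv Hy Hz H. fdestruct H as [H Hn]. fobtain (Le_e H) as [a [b [Ha [Hb Hab]]]].
  pose proof (FregeNum_succ Hx Hv Hy) as HFy.
  fhave D : (a ≡ b ∨ ∃ e, e ∈ b ∧ e ∉ a).
  { fapply (Sep_dec HFy); [exact Hb|exact Hab]. }
  fdestruct D as [E|[e [Heb Hea]]].
  - apply bot_e. fapply Hn. fapply (FregeNum_uniq Hz); [exact HFy|exact Ha|]. set_solver.
  - fapply Hy in Hb. fobtain (Del_ex b e) as [r Hr].
    fhave Hrx : (r ∈ x).
    { fapply (FregeNum_remove Hx); [exact Hb|exact Heb|exact Hr]. }
    pose proof (Sep_Del Hab Hea Hr) as Har.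
    fhave D : (a ≡ r ∨ ∃ e, e ∈ r ∧ e ∉ a).
    { fapply (Sep_dec Hx); [exact Hrx|exact Har]. }
    fdestruct D as [E|[e' [Her Hea']]].
    + fright. fsubst E. fapply (FregeNum_uniq Hz); [exact Hx|exact Ha|exact Hrx].
    + fleft. fsplit; [exact (Le_i Ha Hrx Har)|]. fintros E. fsubst E.
      fdestruct Har as [Har _]. exact (no_proper _ Hx Ha Hrx Har Her Hea').
Qed.

Lemma Lt_succ_i {w x y z v} :
  (w ⊩ FregeNum x) -> (w ⊩ in_succ v x) -> (w ⊩ Succ y x) -> (w ⊩ FregeNum z) ->
  (w ⊩ Lt z x ∨ z ≡ x) -> w ⊩ Lt z y.
Proof.
  intros Hx Hv Hy Hz H. pose proof Hv as Hv'.
  fhave Hvy : (v ∈ y) by (fapply Hy; exact Hv).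
  fdestruct Hv' as [u [c [Hu [Hc Hvu]]]]. fdestruct H as [H|E].
  - fdestruct H as [H _]. fobtain (Le_e H) as [a [b [Ha [Hb Hab]]]]. fsplit.
    + fhave K : (∃ a', a' ∈ z ∧ Sep a' u).
      { fapply (Sep_move Hx); [exact Hz|exact Ha|exact Hb|exact Hab|exact Hu]. }
      fdestruct K as [a' [Ha' Hau]].
      exact (Le_i Ha' Hvy (Sep_Adj Hau Hc Hvu)).
    (* If z were y, then [a], a member of the successor of x, would be included in the member [b] of
       x. *)
    + fintros E. fsubst E. fapply Hy in Ha. fdestruct Hab as [Hab _].
      fapply (no_succ_subset Hx); [exact Ha|exact Hb|exact Hab].
  - fsubst E. fsplit.
    + exact (Le_i Hu Hvy (Sep_Adj_self Hc Hvu)).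
    + fintros E. fhave Hvx : (v ∈ x) by set_solver.
      fapply (no_succ_subset Hx); [exact Hv|exact Hvx|]. set_solver.
Qed.

Lemma zero_least {w z y} : (w ⊩ Zero z) -> (w ⊩ FregeNum y) -> w ⊩ Lt z y ∨ z ≡ y.
Proof.
  intros Hz Hy. frege_ind y Hy.
  - fintros y Hy. fright. exact (same_ext Hz Hy).
  - fintros y y' u Hy IH Hu Hy'. fleft. exact (Lt_succ_i Hy Hu Hy' (FregeNum_zero Hz) IH).
Qed.

Lemma Succ_eq {w x x' y y'} :
  (w ⊩ x ≡ y) -> (w ⊩ Succ x' x) -> (w ⊩ Succ y' y) -> w ⊩ x' ≡ y'.
Proof. intros E Hx Hy. fsubst E. exact (same_ext Hx Hy). Qed.

Lemma Lt_succ_l {w x x' u y} :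
  (w ⊩ FregeNum x) -> (w ⊩ in_succ u x) -> (w ⊩ Succ x' x) -> (w ⊩ FregeNum y) ->
  w ⊩ Lt x y ⇒ Lt x' y ∨ x' ≡ y.
Proof.
  intros Hx Hu Hx' Hy. pose proof (FregeNum_succ Hx Hu Hx') as HF. frege_ind y Hy.
  - fintros y Hy. fintros H. exact (Lt_zero _ Hy Hx H).
  - fintros y y' v Hy IH Hv Hy'. fintros H. fobtain (Lt_succ_e Hy Hv Hy' Hx H) as [H1|E].
    + fleft. apply (Lt_succ_i Hy Hv Hy' HF). fapply IH. exact H1.
    + fright. exact (Succ_eq E Hx' Hy').
Qed.

Lemma trichotomy {w x} : (w ⊩ FregeNum x) -> w ⊩ ∀ y, FregeNum y ⇒ Lt x y ∨ x ≡ y ∨ Lt y x.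
Proof.
  intros Hx. frege_ind x Hx.
  - fintros x Hx. fintros y Hy. fobtain (zero_least Hx Hy) as [H|H].
    + fleft. exact H.
    + fright. fleft. exact H.
  - fintros x x' u Hx IH Hu Hx'. fintros y Hy.
    fhave K : (Lt x y ∨ x ≡ y ∨ Lt y x) by (fapply IH; exact Hy).
    fdestruct K as [H|[E|H]].
    + fhave K : (Lt x' y ∨ x' ≡ y) by (fapply (Lt_succ_l Hx Hu Hx' Hy); exact H).
      fdestruct K as [K|K]; [fleft|fright; fleft]; exact K.
    + fright. fright. apply (Lt_succ_i Hx Hu Hx' Hy). fright. now apply eq_sym_tv.
    + fright. fright. apply (Lt_succ_i Hx Hu Hx' Hy). fleft. exact H.
Qed.

Lemma Lt_trans {w a b c} : (w ⊩ FregeNum a) -> (w ⊩ FregeNum b) -> (w ⊩ FregeNum c) ->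
  (w ⊩ Lt a b) -> (w ⊩ Lt b c) -> w ⊩ Lt a c.
Proof.
  intros Ha Hb Hc Hab Hbc. enough (K : w ⊩ Lt b c ⇒ Lt a c) by (fapply K; exact Hbc).
  clear Hbc. frege_ind c Hc.
  - fintros c Hc. fintros H. exact (Lt_zero _ Hc Hb H).
  - fintros c c' u Hc IH Hu Hc'. fintros H. apply (Lt_succ_i Hc Hu Hc' Ha). fleft.
    fobtain (Lt_succ_e Hc Hu Hc' Hb H) as [H1|E].
    + fapply IH. exact H1.
    + fsubst E. exact Hab.
Qed.

(** * Cardinals of initial segments *)

Definition Seg s x := ∀ z, z ∈ s ⇔ FregeNum z ∧ Lt z x.
Definition SegCard x y := FregeNum x ∧ FregeNum y ∧ ∃ s, Seg s x ∧ s ∈ y.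

Lemma Seg_ex {w} x : w ⊩ ∃ s, Seg s x.
Proof. comprehend. Qed.

Lemma SegCard_zero {w z} : (w ⊩ Zero z) -> w ⊩ SegCard z z.
Proof.
  intros Hz. pose proof (FregeNum_zero Hz) as HF. repeat fsplit; try assumption.
  fobtain (Seg_ex z) as [s Hs]. fexists s. fsplit; [exact Hs|]. fapply Hz.
  fintros t. fsplit.
  - fintros Ht. fapply Hs in Ht. fdestruct Ht as [Ht Hl]. exact (Lt_zero _ Hz Ht Hl).
  - fintros H. now apply bot_e.
Qed.

(** The segment below [x'] is the segment below x with x adjoined, and x is new by irreflexivity.
    This set shows both that the successor of y is inhabited and that it is the right value. *)
Lemma SegCard_succ {w x y x' y' u} :
  (w ⊩ SegCard x y) -> (w ⊩ in_succ u x) -> (w ⊩ Succ x' x) -> (w ⊩ Succ y' y) ->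
  w ⊩ SegCard x' y' ∧ ∃ v, in_succ v y.
Proof.
  intros H Hu Hx' Hy'. fdestruct H as [Hx [Hy [s [Hs Hsy]]]].
  fobtain (Seg_ex x') as [s' Hs'].
  fhave K : (in_succ s' y).
  { fexists s. fexists x. repeat fsplit; [exact Hsy| |].
    - fintros H. fapply Hs in H. fdestruct H as [_ H]. fdestruct H as [_ H]. fapply H.
    apply eq_refl_tv.
    - fintros z. fsplit.
      + fintros Hz. fapply Hs' in Hz. fdestruct Hz as [Hz Hl].
        fobtain (Lt_succ_e Hx Hu Hx' Hz Hl) as [H1|E].
        * fleft. fapply Hs. fsplit; assumption.
        * fright. exact E.
      + fintros H. fapply Hs'. fdestruct H as [H|E].
        * fapply Hs in H. fdestruct H as [Hz Hl]. fsplit; [exact Hz|].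
          apply (Lt_succ_i Hx Hu Hx' Hz). fleft. exact Hl.
        * fsubst E. fsplit; [exact Hx|].
          apply (Lt_succ_i Hx Hu Hx' Hx). fright. apply eq_refl_tv. }
  fsplit; [|fexists s'; exact K].
  repeat fsplit; [exact (FregeNum_succ Hx Hu Hx')|exact (FregeNum_succ Hy K Hy')|].
  fexists s'. fsplit; [exact Hs'|]. fapply Hy'. exact K.
Qed.

Lemma SegCard_Frege {w x y} : (w ⊩ SegCard x y) -> (w ⊩ FregeNum x) /\ (w ⊩ FregeNum y).
Proof. intros [H1 [H2 _]]. split; assumption. Qed.

Lemma SegCard_fun {w x y z} : (w ⊩ SegCard x y) -> (w ⊩ SegCard x z) -> w ⊩ y ≡ z.
Proof.
  intros Hy Hz. fdestruct Hy as [Hx [Hy [s [Hs Hsy]]]]. fdestruct Hz as [_ [Hz [s' [Hs' Hsz]]]].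
  pose proof (same_ext Hs Hs') as E. fsubst E.
  fapply (FregeNum_uniq Hy); [exact Hz|exact Hsy|exact Hsz].
Qed.

Lemma SegCard_total {w x} : (w ⊩ FregeNum x) -> w ⊩ ∃ y, SegCard x y.
Proof.
  intros Hx. frege_ind x Hx.
  - fintros z Hz. fexists z. exact (SegCard_zero Hz).
  - fintros x x' u Hx IH Hu Hx'. fdestruct IH as [y Hy]. fobtain (Succ_ex y) as [y' Hy'].
    fobtain (SegCard_succ Hy Hu Hx' Hy') as [H _]. fexists y'. exact H.
Qed.

(** Induction on the larger argument: below a successor, x is either below the predecessor or equal
    to it, and in both cases its value lies below the successor of the predecessor's value. *)
Lemma SegCard_mono {w x'} : (w ⊩ FregeNum x') ->
  w ⊩ ∀ x y y', Lt x x' ⇒ SegCard x y ⇒ SegCard x' y' ⇒ Lt y y'.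
Proof.
  intros Hx. frege_ind x' Hx.
  - fintros z Hz. fintros x y y' Hl H _. destruct (SegCard_Frege H) as [Hx _].
  exact (Lt_zero _ Hz Hx Hl).
  - fintros x1 x2 u Hx1 IH Hu Hx2. fintros x y y2 Hl Hxy Hxy2.
    fobtain (SegCard_total Hx1) as [y1 Hy1]. fobtain (Succ_ex y1) as [y3 Hy3].
    fobtain (SegCard_succ Hy1 Hu Hx2 Hy3) as [H3 [v Hv]].
    pose proof (SegCard_fun H3 Hxy2) as E. destruct (SegCard_Frege Hxy) as [Hx Hy].
    destruct (SegCard_Frege Hy1) as [_ HFy1].
    fhave K : (Lt y y3).
    { apply (Lt_succ_i HFy1 Hv Hy3 Hy). fobtain (Lt_succ_e Hx1 Hu Hx2 Hx Hl) as [H1|E1].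
      - fleft. fapply IH; [exact H1|exact Hxy|exact Hy1].
      - fright. fsubst E1. exact (SegCard_fun Hxy Hy1). }
    fsubst E. exact K.
Qed.

Lemma Lt_irrefl {w x} (P : tv) : (w ⊩ Lt x x) -> w ⊩ P.
Proof. intros H. apply bot_e. fdestruct H as [_ H]. fapply H. apply eq_refl_tv. Qed.

(** Monotonicity carries an inequality between x and y once around the cycle, and transitivity then
    contradicts irreflexivity. *)
Lemma SegCard_cycle {w x y z} : (w ⊩ SegCard x y) -> (w ⊩ SegCard y z) -> (w ⊩ SegCard z x) ->
  w ⊩ SegCard x x.
Proof.
  intros Hxy Hyz Hzx. destruct (SegCard_Frege Hxy) as [Hx Hy].
  destruct (SegCard_Frege Hyz) as [_ Hz].
  fhave K : (Lt x y ∨ x ≡ y ∨ Lt y x) by (fapply (trichotomy Hx); exact Hy).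
  fdestruct K as [H|[E|H]].
  - fhave H1 : (Lt y z) by (fapply (SegCard_mono Hy); [exact H|exact Hxy|exact Hyz]).
    fhave H2 : (Lt z x) by (fapply (SegCard_mono Hz); [exact H1|exact Hyz|exact Hzx]).
    exact (Lt_irrefl _ (Lt_trans Hx Hy Hx H (Lt_trans Hy Hz Hx H1 H2))).
  - pose proof (eq_sym_tv _ _ _ E) as E'. fsubst E'. exact Hxy.
  - fhave H1 : (Lt z y) by (fapply (SegCard_mono Hx); [exact H|exact Hyz|exact Hxy]).
    fhave H2 : (Lt x z) by (fapply (SegCard_mono Hy); [exact H1|exact Hzx|exact Hyz]).
    exact (Lt_irrefl _ (Lt_trans Hx Hz Hx H2 (Lt_trans Hz Hy Hx H1 H))).
Qed.

Definition SegCard3 x u := ∃ y z, SegCard x y ∧ SegCard y z ∧ SegCard z u.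

Lemma SegCard3_zero {w z} : (w ⊩ Zero z) -> w ⊩ SegCard3 z z.
Proof.
  intros Hz. fexists z. fexists z. fsplit; [|fsplit]; exact (SegCard_zero Hz).
Qed.

Lemma SegCard3_succ {w x u x' u' v} :
  (w ⊩ SegCard3 x u) -> (w ⊩ in_succ v x) -> (w ⊩ Succ x' x) -> (w ⊩ Succ u' u) ->
  w ⊩ SegCard3 x' u'.
Proof.
  intros H Hv Hx' Hu'. fdestruct H as [y [z [Hxy [Hyz Hzu]]]].
  fobtain (Succ_ex y) as [y' Hy']. fobtain (Succ_ex z) as [z' Hz'].
  fobtain (SegCard_succ Hxy Hv Hx' Hy') as [H1 [v1 Hv1]].
  fobtain (SegCard_succ Hyz Hv1 Hy' Hz') as [H2 [v2 Hv2]].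
  fobtain (SegCard_succ Hzu Hv2 Hz' Hu') as [H3 _].
  fexists y'. fexists z'. fsplit; [|fsplit]; assumption.
Qed.

(** * Church numbers *)

(* The pair of the classes {t : A t} and {t : B t}; the pairs of the statement
   have set abstracts as components. *)
Definition class_pair v (A B : nat -> tv) :=
  ∀ u, u ∈ v ⇔ (∀ t, t ∈ u ⇔ A t) ∨ ∀ t, t ∈ u ⇔ A t ∨ B t.
Definition pair v a b := class_pair v (fun t => t ≡ a) (fun t => t ≡ b).
Definition pair_in a b f := ∃ v, pair v a b ∧ v ∈ f.
Definition Func f := ∀ x y z, pair_in x y f ⇒ pair_in x z f ⇒ y ≡ z.
Definition Identity i := ∀ u, u ∈ i ⇔ ∃ x, x ≡ x ∧ pair u x x.
Definition ChurchZero z := ∀ u, u ∈ z ⇔ ∃ f, f ≡ f ∧ class_pair u (fun t => t ≡ f) Identity.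
(** The graph of x ↦ f (z f x), the value at f of the Church successor of z. *)
Definition in_comp u f z :=
  ∃ x w t q, pair u x w ∧ Func t ∧ pair_in f t z ∧ pair_in x q t ∧ pair_in q w f.
Definition Comp p f z := ∀ u, u ∈ p ⇔ in_comp u f z.
Definition in_step v z := ∃ f p, Func f ∧ Comp p f z ∧ pair v f p.
Definition Step s z := ∀ v, v ∈ s ⇔ in_step v z.
Definition in_csucc v := ∃ z, Func z ∧ class_pair v (fun t => t ≡ z) (fun t => Step t z).
Definition ap_csucc t x := ∃ y, (∃ v, pair v x y ∧ in_csucc v) ∧ t ∈ y.
Definition ChurchNum n := ∀ w,
  (∃ z, ChurchZero z ∧ z ∈ w)
  ∧ (∀ x, x ∈ w ⇒ ∃ a, (∀ t, t ∈ a ⇔ ap_csucc t x) ∧ a ∈ w) ⇒ n ∈ w.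

Lemma iff_refl {w P} : w ⊩ P ⇔ P.
Proof. fsplit; fintros H; exact H. Qed.

Lemma iff_congr_iff {w P P' Q Q'} :
  (w ⊩ P ⇔ P') -> (w ⊩ Q ⇔ Q') -> w ⊩ (P ⇔ Q) ⇔ (P' ⇔ Q').
Proof.
  intros HP HQ. fsplit; fintros H; fsplit; fintros K;
    solve [fapply HQ; fapply H; fapply HP; exact K | fapply HP; fapply H; fapply HQ; exact K].
Qed.

Lemma iff_congr_or {w P P' Q Q'} :
  (w ⊩ P ⇔ P') -> (w ⊩ Q ⇔ Q') -> w ⊩ (P ∨ Q) ⇔ (P' ∨ Q').
Proof.
  intros HP HQ. fsplit; fintros H; fdestruct H as [H|H];
    (fleft; fapply HP; exact H) || (fright; fapply HQ; exact H).
Qed.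

Lemma iff_congr_all {w P Q} : (w ⊩ ∀ x, P x ⇔ Q x) -> w ⊩ tall P ⇔ tall Q.
Proof.
  intros HP. fsplit; fintros H; fintros x; fapply HP; exact (all_e _ _ H x).
Qed.

(** Lets a defining formula such as [Identity] be exchanged for equality with a set that satisfies
    it, which turns a [class_pair] into a [pair]. *)
Lemma class_pair_iff {w v A A' B B'} :
  (w ⊩ ∀ t, A t ⇔ A' t) -> (w ⊩ ∀ t, B t ⇔ B' t) -> w ⊩ class_pair v A B ⇔ class_pair v A' B'.
Proof.
  intros HA HB. apply iff_congr_all. fintros u. apply iff_congr_iff; [apply iff_refl|].
  apply iff_congr_or; apply iff_congr_all; fintros t; apply iff_congr_iff; try apply iff_refl.
  - exact (all_e _ _ HA t).
  - apply iff_congr_or; [exact (all_e _ _ HA t)|exact (all_e _ _ HB t)].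
Qed.

Lemma pair_ex {w} a b : w ⊩ ∃ v, pair v a b.
Proof. comprehend. Qed.

Lemma Sing_ex {w} a : w ⊩ ∃ s, ∀ t, t ∈ s ⇔ t ≡ a.
Proof. comprehend. Qed.

Lemma Doub_ex {w} a b : w ⊩ ∃ s, ∀ t, t ∈ s ⇔ t ≡ a ∨ t ≡ b.
Proof. comprehend. Qed.

(** The singleton of a belongs to [v], so it is {a'} or {a', b'}, and both contain a'. *)
Lemma pair_fst {w v a b a' b'} : (w ⊩ pair v a b) -> (w ⊩ pair v a' b') -> w ⊩ a ≡ a'.
Proof.
  intros H H'. fobtain (Sing_ex a) as [s Hs].
  fhave K : (s ∈ v) by (fapply H; fleft; exact Hs).
  fapply H' in K. apply eq_sym_tv. fdestruct K as [K|K].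
  - fapply Hs. fapply K. apply eq_refl_tv.
  - fapply Hs. fapply K. fleft. apply eq_refl_tv.
Qed.

Lemma pair_snd_or {w v a b b'} :
  (w ⊩ pair v a b) -> (w ⊩ pair v a b') -> w ⊩ b ≡ a ∨ b ≡ b'.
Proof.
  intros H H'. fobtain (Doub_ex a b) as [s Hs].
  fhave K : (s ∈ v) by (fapply H; fright; exact Hs).
  fhave Hb : (b ∈ s) by (fapply Hs; fright; apply eq_refl_tv).
  fapply H' in K. fdestruct K as [K|K].
  - fleft. fapply K. exact Hb.
  - fapply K. exact Hb.
Qed.

(** Using [pair_snd_or] in both directions leaves only the case where b and b' both equal a, so it
    never has to be decided whether a pair is degenerate. *)
Lemma pair_snd {w v a b a' b'} : (w ⊩ pair v a b) -> (w ⊩ pair v a' b') -> w ⊩ b ≡ b'.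
Proof.
  intros H H'. pose proof (pair_fst H H') as E. fsubst E.
  fobtain (pair_snd_or H H') as [E|E]; [|exact E].
  fobtain (pair_snd_or H' H) as [E'|E']; [|now apply eq_sym_tv].
  exact (eq_trans_tv _ _ _ _ E (eq_sym_tv _ _ _ E')).
Qed.

Lemma pair_in_i {w v a b f} : (w ⊩ pair v a b) -> (w ⊩ v ∈ f) -> w ⊩ pair_in a b f.
Proof. intros H Hv. fexists v. fsplit; assumption. Qed.

Lemma Identity_ex {w} : w ⊩ ∃ i, Identity i.
Proof. comprehend. Qed.
Lemma ChurchZero_ex {w} : w ⊩ ∃ z, ChurchZero z.
Proof. comprehend. Qed.
Lemma Comp_ex {w} f z : w ⊩ ∃ p, Comp p f z.
Proof. comprehend. Qed.
Lemma Step_ex {w} z : w ⊩ ∃ s, Step s z.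
Proof. comprehend. Qed.

Lemma pair_in_Identity_i {w i} x : (w ⊩ Identity i) -> w ⊩ pair_in x x i.
Proof.
  intros Hi. fobtain (pair_ex x x) as [v Hv]. apply (pair_in_i Hv). fapply Hi. fexists x.
  fsplit; [apply eq_refl_tv|exact Hv].
Qed.

Lemma pair_in_Identity_e {w i x y} : (w ⊩ Identity i) -> (w ⊩ pair_in x y i) -> w ⊩ x ≡ y.
Proof.
  intros Hi H. fdestruct H as [v [Hv H]]. fapply Hi in H. fdestruct H as [z [_ Hz]].
  exact (eq_trans_tv _ _ _ _ (pair_fst Hv Hz) (eq_sym_tv _ _ _ (pair_snd Hv Hz))).
Qed.

Lemma Func_Identity {w i} : (w ⊩ Identity i) -> w ⊩ Func i.
Proof.
  intros Hi. fintros x y z Hy Hz.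
  exact (eq_trans_tv _ _ _ _ (eq_sym_tv _ _ _ (pair_in_Identity_e Hi Hy)) (pair_in_Identity_e Hi Hz)).
Qed.

Lemma class_pair_Identity {w i u f} : (w ⊩ Identity i) ->
  w ⊩ class_pair u (fun t => t ≡ f) Identity ⇔ pair u f i.
Proof.
  intros Hi. apply class_pair_iff; [fintros t; apply iff_refl|]. fintros t. fsplit.
  - fintros Ht. exact (same_ext Ht Hi).
  - fintros E. pose proof (eq_sym_tv _ _ _ E) as E'. fsubst E'. exact Hi.
Qed.

Lemma pair_in_ChurchZero_i {w z i} f : (w ⊩ ChurchZero z) -> (w ⊩ Identity i) ->
  w ⊩ pair_in f i z.
Proof.
  intros Hz Hi. fobtain (pair_ex f i) as [v Hv]. apply (pair_in_i Hv). fapply Hz. fexists f.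
  fsplit; [apply eq_refl_tv|]. exact (iff_r _ _ _ (class_pair_Identity Hi) Hv).
Qed.

Lemma pair_in_ChurchZero_e {w z i f y} : (w ⊩ ChurchZero z) -> (w ⊩ Identity i) ->
  (w ⊩ pair_in f y z) -> w ⊩ y ≡ i.
Proof.
  intros Hz Hi H. fdestruct H as [v [Hv H]]. fapply Hz in H. fdestruct H as [g [_ H]].
  assert (K := iff_l _ _ _ (class_pair_Identity Hi) H). clear H. rename K into H.
  exact (pair_snd Hv H).
Qed.

Lemma Func_ChurchZero {w z} : (w ⊩ ChurchZero z) -> w ⊩ Func z.
Proof.
  intros Hz. fobtain Identity_ex as [i Hi]. fintros x y y' Hy Hy'.
  exact (eq_trans_tv _ _ _ _ (pair_in_ChurchZero_e Hz Hi Hy) (eq_sym_tv _ _ _ (pair_in_ChurchZero_e Hz Hi Hy'))).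
Qed.

Lemma pair_in_Comp_i {w p f z x q t v} : (w ⊩ Comp p f z) -> (w ⊩ Func t) ->
  (w ⊩ pair_in f t z) -> (w ⊩ pair_in x q t) -> (w ⊩ pair_in q v f) -> w ⊩ pair_in x v p.
Proof.
  intros Hp Ht Hz Hx Hq. fobtain (pair_ex x v) as [u Hu]. apply (pair_in_i Hu). fapply Hp.
  fexists x. fexists v. fexists t. fexists q. fsplit; [exact Hu|]. fsplit; [exact Ht|].
  fsplit; [exact Hz|]. fsplit; assumption.
Qed.

Lemma pair_in_Comp_e {w p f z x v} : (w ⊩ Comp p f z) -> (w ⊩ pair_in x v p) ->
  w ⊩ ∃ t q, Func t ∧ pair_in f t z ∧ pair_in x q t ∧ pair_in q v f.
Proof.
  intros Hp H. fdestruct H as [u [Hu H]]. fapply Hp in H.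
  fdestruct H as [x' [v' [t [q [Hu' [Ht [Hz [Hx Hq]]]]]]]].
  pose proof (eq_sym_tv _ _ _ (pair_fst Hu Hu')) as E1.
  pose proof (eq_sym_tv _ _ _ (pair_snd Hu Hu')) as E2.
  clear Hu'. fsubst E1. fsubst E2. fexists t. fexists q. repeat (fsplit; [assumption|]).
  assumption.
Qed.

Lemma Func_e {w f x y z} : (w ⊩ Func f) -> (w ⊩ pair_in x y f) -> (w ⊩ pair_in x z f) ->
  w ⊩ y ≡ z.
Proof. intros Hf Hy Hz. fapply Hf; [exact Hy|exact Hz]. Qed.

Lemma Func_Comp {w p f z} : (w ⊩ Func f) -> (w ⊩ Func z) -> (w ⊩ Comp p f z) -> w ⊩ Func p.
Proof.
  intros Hf Hz Hp. fintros x y y' Hy Hy'.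
  fobtain (pair_in_Comp_e Hp Hy) as [t [q [Ht [Htz [Hx Hq]]]]].
  fobtain (pair_in_Comp_e Hp Hy') as [t' [q' [Ht' [Htz' [Hx' Hq']]]]].
  pose proof (Func_e Hz Htz Htz') as E. fsubst E.
  pose proof (Func_e Ht Hx Hx') as E. fsubst E.
  exact (Func_e Hf Hq Hq').
Qed.

Lemma pair_in_Step_i {w s z f p} :
  (w ⊩ Step s z) -> (w ⊩ Func f) -> (w ⊩ Comp p f z) -> w ⊩ pair_in f p s.
Proof.
  intros Hs Hf Hp. fobtain (pair_ex f p) as [v Hv]. apply (pair_in_i Hv). fapply Hs.
  fexists f. fexists p. fsplit; [exact Hf|]. fsplit; assumption.
Qed.

Lemma pair_in_Step_e {w s z f p} :
  (w ⊩ Step s z) -> (w ⊩ pair_in f p s) -> (w ⊩ Func f ∧ Comp p f z).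
Proof.
  intros Hs H. fdestruct H as [v [Hv H]]. fapply Hs in H. fdestruct H as [f' [p' [Hf [Hp Hv']]]].
  pose proof (eq_sym_tv _ _ _ (pair_fst Hv Hv')) as E1.
  pose proof (eq_sym_tv _ _ _ (pair_snd Hv Hv')) as E2.
  clear Hv'. fsubst E1. fsubst E2. fsplit; assumption.
Qed.

Lemma Func_Step {w s z} : (w ⊩ Step s z) -> w ⊩ Func s.
Proof.
  intros Hs. fintros f p p' Hp Hp'.
  fobtain (pair_in_Step_e Hs Hp) as [_ K]. fobtain (pair_in_Step_e Hs Hp') as [_ K'].
  exact (same_ext K K').
Qed.

Lemma class_pair_Step {w s u z} : (w ⊩ Step s z) ->
  w ⊩ class_pair u (fun t => t ≡ z) (fun t => Step t z) ⇔ pair u z s.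
Proof.
  intros Hs. apply class_pair_iff; [fintros t; apply iff_refl|]. fintros t. fsplit.
  - fintros Ht. exact (same_ext Ht Hs).
  - fintros E. pose proof (eq_sym_tv _ _ _ E) as E'. fsubst E'. exact Hs.
Qed.

Lemma in_csucc_i {w v z s} :
  (w ⊩ Func z) -> (w ⊩ Step s z) -> (w ⊩ pair v z s) -> w ⊩ in_csucc v.
Proof.
  intros Hz Hs Hv. fexists z. fsplit; [exact Hz|]. exact (iff_r _ _ _ (class_pair_Step Hs) Hv).
Qed.

Lemma in_csucc_e {w v z s} :
  (w ⊩ in_csucc v) -> (w ⊩ pair v z s) -> w ⊩ Func z ∧ Step s z.
Proof.
  intros H Hv. fdestruct H as [z' [Hz H]]. fobtain (Step_ex z') as [s' Hs].
  assert (K := iff_l _ _ _ (class_pair_Step Hs) H). clear H. rename K into H.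
  pose proof (eq_sym_tv _ _ _ (pair_fst Hv H)) as E1.
  pose proof (eq_sym_tv _ _ _ (pair_snd Hv H)) as E2.
  clear H. fsubst E1. fsubst E2. fsplit; assumption.
Qed.

Lemma ap_csucc_iff {w x s} : (w ⊩ Func x) -> (w ⊩ Step s x) -> w ⊩ ∀ t, t ∈ s ⇔ ap_csucc t x.
Proof.
  intros Hx Hs. fintros t. fsplit.
  - fintros Ht. fexists s. fsplit; [|exact Ht]. fobtain (pair_ex x s) as [v Hv]. fexists v.
    fsplit; [exact Hv|exact (in_csucc_i Hx Hs Hv)].
  - fintros H. fdestruct H as [y [[v [Hv H]] Ht]]. fobtain (in_csucc_e H Hv) as [_ Hy].
    pose proof (same_ext Hy Hs) as E. fsubst E. exact Ht.
Qed.

Lemma ChurchNum_zero {w z} : (w ⊩ ChurchZero z) -> w ⊩ ChurchNum z.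
Proof.
  intros Hz. fintros v H. fdestruct H as [[z' [Hz' Hv]] _].
  pose proof (same_ext Hz' Hz) as E. fsubst E. exact Hv.
Qed.

Lemma ChurchNum_succ {w j s} : (w ⊩ Func j) -> (w ⊩ ChurchNum j) -> (w ⊩ Step s j) ->
  w ⊩ ChurchNum s.
Proof.
  intros Hj Hn Hs. fintros v H. fhave K : (j ∈ v) by (fapply Hn; exact H).
  fdestruct H as [_ H]. fapply H in K. fdestruct K as [a [Ha Hv]].
  pose proof (same_ext Ha (ap_csucc_iff Hj Hs)) as E. fsubst E. exact Hv.
Qed.

Lemma ChurchNum_ind {w P} :
  (w ⊩ ∃ v, ∀ x, x ∈ v ⇔ P x) ->
  (w ⊩ ∀ z, ChurchZero z ⇒ P z) ->
  (w ⊩ ∀ j s, Func j ⇒ P j ⇒ Step s j ⇒ P s) ->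
  forall n, (w ⊩ ChurchNum n) -> w ⊩ Func n ∧ P n.
Proof.
  intros HP H0 HS n Hn. fdestruct HP as [v Hv].
  (* Church successor is defined on functions only, so functionality is built into the inductive
     set. *)
  fhave HV : (∃ y, ∀ x, x ∈ y ⇔ Func x ∧ x ∈ v) by comprehend.
  fdestruct HV as [V HV].
  fhave K : (n ∈ V).
  { fapply Hn. fsplit.
    - fobtain ChurchZero_ex as [z Hz]. fexists z. fsplit; [exact Hz|].
      fapply HV. fsplit; [now apply Func_ChurchZero|]. fapply Hv. now fapply H0.
    - fintros x Hx. fapply HV in Hx. fdestruct Hx as [Hx Hxv]. fapply Hv in Hxv.
      fobtain (Step_ex x) as [s Hs]. fexists s. fsplit; [exact (ap_csucc_iff Hx Hs)|].
      fapply HV. fsplit; [exact (Func_Step Hs)|]. fapply Hv. fapply HS;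
    [exact Hx|exact Hxv|exact Hs]. }
  fapply HV in K. fdestruct K as [Hf K]. fapply Hv in K. fsplit; assumption.
Qed.

(** * Iteration and the counting axioms *)

(** States j f u = v through graphs instead of [Ap]; [Func t] matches the demand that [in_comp]
    makes on the value of a Church number. *)
Definition Iter j f u v := ∃ t, Func t ∧ pair_in f t j ∧ pair_in u v t.
Definition FregeSuccGraph g := ∀ v, v ∈ g ⇔ ∃ x y, Succ y x ∧ pair v x y.
Definition ChurchSucc c := ∀ v, v ∈ c ⇔ in_csucc v.

Lemma Iter_zero {w z f u} : (w ⊩ ChurchZero z) -> w ⊩ Iter z f u u.
Proof.
  intros Hz. fobtain Identity_ex as [i Hi]. fexists i.
  fsplit; [exact (Func_Identity Hi)|]. fsplit;
    [exact (pair_in_ChurchZero_i f Hz Hi)|exact (pair_in_Identity_i u Hi)].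
Qed.

Lemma Iter_zero_e {w z f u v} : (w ⊩ ChurchZero z) -> (w ⊩ Iter z f u v) -> w ⊩ u ≡ v.
Proof.
  intros Hz H. fobtain Identity_ex as [i Hi]. fdestruct H as [t [_ [Ht H]]].
  pose proof (pair_in_ChurchZero_e Hz Hi Ht) as E. fsubst E. exact (pair_in_Identity_e Hi H).
Qed.

Lemma Iter_succ {w j s f u v v'} : (w ⊩ Func j) -> (w ⊩ Func f) -> (w ⊩ Step s j) ->
  (w ⊩ Iter j f u v) -> (w ⊩ pair_in v v' f) -> w ⊩ Iter s f u v'.
Proof.
  intros Hj Hf Hs H Hv. fdestruct H as [t [Ht [Hft Hu]]]. fobtain (Comp_ex f j) as [p Hp].
  fexists p. fsplit; [exact (Func_Comp Hf Hj Hp)|].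
  fsplit; [exact (pair_in_Step_i Hs Hf Hp)|exact (pair_in_Comp_i Hp Ht Hft Hu Hv)].
Qed.

Lemma Iter_succ_e {w j s f u v'} : (w ⊩ Step s j) -> (w ⊩ Iter s f u v') ->
  w ⊩ ∃ v, Iter j f u v ∧ pair_in v v' f.
Proof.
  intros Hs H. fdestruct H as [p [_ [Hfp Hu]]]. fobtain (pair_in_Step_e Hs Hfp) as [_ Hp].
  fobtain (pair_in_Comp_e Hp Hu) as [t [q [Ht [Hft [Hq Hv]]]]].
  fexists q. fsplit; [|exact Hv]. fexists t. fsplit; [exact Ht|]. fsplit; assumption.
Qed.

Lemma Iter_fun {w j f u v v'} : (w ⊩ Func j) ->
  (w ⊩ Iter j f u v) -> (w ⊩ Iter j f u v') -> w ⊩ v ≡ v'.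
Proof.
  intros Hj H H'. fdestruct H as [t [Ht [Hft Hu]]]. fdestruct H' as [t' [_ [Hft' Hu']]].
  pose proof (Func_e Hj Hft Hft') as E. fsubst E. exact (Func_e Ht Hu Hu').
Qed.

Lemma FregeSuccGraph_ex {w} : w ⊩ ∃ g, FregeSuccGraph g.
Proof. comprehend. Qed.
Lemma ChurchSucc_ex {w} : w ⊩ ∃ c, ChurchSucc c.
Proof. comprehend. Qed.
Lemma ChurchNum_ex {w} : w ⊩ ∃ n, ∀ j, j ∈ n ⇔ ChurchNum j.
Proof. comprehend. Qed.

Lemma pair_in_FregeSucc_i {w g x y} : (w ⊩ FregeSuccGraph g) -> (w ⊩ Succ y x) ->
  w ⊩ pair_in x y g.
Proof.
  intros Hg H. fobtain (pair_ex x y) as [v Hv]. apply (pair_in_i Hv). fapply Hg.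
  fexists x. fexists y. fsplit; assumption.
Qed.

Lemma pair_in_FregeSucc_e {w g x y} : (w ⊩ FregeSuccGraph g) -> (w ⊩ pair_in x y g) ->
  w ⊩ Succ y x.
Proof.
  intros Hg H. fdestruct H as [v [Hv H]]. fapply Hg in H. fdestruct H as [x' [y' [H Hv']]].
  pose proof (eq_sym_tv _ _ _ (pair_fst Hv Hv')) as E1.
  pose proof (eq_sym_tv _ _ _ (pair_snd Hv Hv')) as E2.
  clear Hv'. fsubst E1. fsubst E2. exact H.
Qed.

Lemma Func_FregeSucc {w g} : (w ⊩ FregeSuccGraph g) -> w ⊩ Func g.
Proof.
  intros Hg. fintros x y z Hy Hz.
  exact (same_ext (pair_in_FregeSucc_e Hg Hy) (pair_in_FregeSucc_e Hg Hz)).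
Qed.

Lemma pair_in_ChurchSucc_i {w c x y} : (w ⊩ ChurchSucc c) -> (w ⊩ Func x) -> (w ⊩ Step y x) ->
  w ⊩ pair_in x y c.
Proof.
  intros Hc Hx Hy. fobtain (pair_ex x y) as [v Hv]. apply (pair_in_i Hv). fapply Hc.
  exact (in_csucc_i Hx Hy Hv).
Qed.

Lemma Func_ChurchSucc {w c} : (w ⊩ ChurchSucc c) -> w ⊩ Func c.
Proof.
  intros Hc. fintros x y y' Hy Hy'. fdestruct Hy as [v [Hv H]]. fdestruct Hy' as [v' [Hv' H']].
  fapply Hc in H. fapply Hc in H'.
  fobtain (in_csucc_e H Hv) as [_ K]. fobtain (in_csucc_e H' Hv') as [_ K'].
  exact (same_ext K K').
Qed.

Lemma ChurchNum_Func {w n} : (w ⊩ ChurchNum n) -> w ⊩ Func n.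
Proof.
  intros Hn. fhave K : (Func n ∧ n ≡ n).
  { apply (@ChurchNum_ind _ (fun n => n ≡ n)); [comprehend| | |exact Hn].
    - fintros z _. apply eq_refl_tv.
    - fintros j s _ _ _. apply eq_refl_tv. }
  fdestruct K as [K _]. exact K.
Qed.

Lemma FregeNum_Iter {w n g z x} :
  (w ⊩ ∀ j, j ∈ n ⇔ ChurchNum j) -> (w ⊩ FregeSuccGraph g) -> (w ⊩ Zero z) -> (w ⊩ FregeNum x) ->
  w ⊩ ∃ j, j ∈ n ∧ Iter j g z x.
Proof.
  intros Hn Hg Hz Hx. frege_ind x Hx.
  - fintros x Hx. fobtain ChurchZero_ex as [c Hc]. fexists c. fsplit.
    + fapply Hn. exact (ChurchNum_zero Hc).
    + pose proof (same_ext Hx Hz) as E. fsubst E. exact (Iter_zero Hc).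
  - fintros x x' u Hx IH Hu Hx'. fdestruct IH as [j [Hj H]]. fapply Hn in Hj.
    pose proof (ChurchNum_Func Hj) as K.
    fobtain (Step_ex j) as [s Hs]. fexists s. fsplit.
    + fapply Hn. exact (ChurchNum_succ K Hj Hs).
    + exact (Iter_succ K (Func_FregeSucc Hg) Hs H (pair_in_FregeSucc_i Hg Hx')).
Qed.

(* The type levels of [g], [z] and of [g'], [z'] differ, so the induction
   formula is stratified only with two copies of each. *)
Lemma iteration_shift {w c o g g' z z' j} :
  (w ⊩ ChurchSucc c) -> (w ⊩ ChurchZero o) -> (w ⊩ FregeSuccGraph g) -> (w ⊩ FregeSuccGraph g') ->
  (w ⊩ Zero z) -> (w ⊩ Zero z') -> (w ⊩ ChurchNum j) ->
  w ⊩ Func j ∧ ∃ k, Func k ∧ Iter j c o k ∧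
    ∀ x a, Iter k g z x ⇒ a ∈ x ⇒ ∃ u, SegCard3 x u ∧ Iter j g' z' u.
Proof.
  intros Hc Ho Hg Hg' Hz Hz' Hj.
  apply (@ChurchNum_ind w (fun j => ∃ k, Func k ∧ Iter j c o k ∧
    ∀ x a, Iter k g z x ⇒ a ∈ x ⇒ ∃ u, SegCard3 x u ∧ Iter j g' z' u)); [comprehend| | |exact Hj].
  - clear Hj. clear j. fintros j Hj. fexists o. fsplit; [exact (Func_ChurchZero Ho)|].
    fsplit; [exact (Iter_zero Hj)|]. fintros x a Hx _.
    pose proof (Iter_zero_e Ho Hx) as E. fexists z. fsplit.
    + fsubst E. pose proof (SegCard3_zero Hz) as K. exact K.
    + pose proof (same_ext Hz' Hz) as E'. fsubst E'. exact (Iter_zero Hj).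
  - clear Hj. clear j. fintros j s Hj IH Hs. fdestruct IH as [k [Hk [Hjk IH]]].
    fobtain (Step_ex k) as [k' Hk']. fexists k'. fsplit; [exact (Func_Step Hk')|].
    fsplit; [exact (Iter_succ Hj (Func_ChurchSucc Hc) Hs Hjk (pair_in_ChurchSucc_i Hc Hk Hk'))|].
    fintros x' a Hx' Ha. fobtain (Iter_succ_e Hk' Hx') as [x [Hx Hxx']].
    (* The guard [a ∈ x] excludes an empty iterate, which is no finite cardinal. It passes down to
       the induction hypothesis because a member of [x'] extends a member [b] of x. *)
    pose proof (pair_in_FregeSucc_e Hg Hxx') as HS. fapply HS in Ha. pose proof Ha as Hb.
    fdestruct Hb as [b [_ [Hb _]]].
    fhave K : (∃ u, SegCard3 x u ∧ Iter j g' z' u) by (fapply IH; [exact Hx|exact Hb]).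
    fdestruct K as [u [Hxu Hju]]. fobtain (Succ_ex u) as [u' Hu']. fexists u'. fsplit.
    + exact (SegCard3_succ Hxu Ha HS Hu').
    + exact (Iter_succ Hj (Func_FregeSucc Hg') Hs Hju (pair_in_FregeSucc_i Hg' Hu')).
Qed.

(* The formula j S 0 = j with its set abstracts eliminated as in Defs. *)
Definition counting_at j :=
  ∀ t, (∃ y, (∃ v, class_pair v ChurchZero (fun t => t ≡ y)
                   ∧ ∃ y', (∃ p, class_pair p ChurchSucc (fun t => t ≡ y') ∧ p ∈ j) ∧ v ∈ y')
             ∧ t ∈ y) ⇔ t ∈ j.

Lemma class_pair_ChurchZero {w v o b} : (w ⊩ ChurchZero o) ->
  w ⊩ class_pair v ChurchZero (fun t => t ≡ b) ⇔ pair v o b.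
Proof.
  intros Ho. apply class_pair_iff; fintros t; [|apply iff_refl]. fsplit.
  - fintros Ht. exact (same_ext Ht Ho).
  - fintros E. pose proof (eq_sym_tv _ _ _ E) as E'. fsubst E'. exact Ho.
Qed.

Lemma class_pair_ChurchSucc {w v c b} : (w ⊩ ChurchSucc c) ->
  w ⊩ class_pair v ChurchSucc (fun t => t ≡ b) ⇔ pair v c b.
Proof.
  intros Hc. apply class_pair_iff; fintros t; [|apply iff_refl]. fsplit.
  - fintros Ht. exact (same_ext Ht Hc).
  - fintros E. pose proof (eq_sym_tv _ _ _ E) as E'. fsubst E'. exact Hc.
Qed.

Lemma counting_eq {w j c o k} : (w ⊩ counting_at j) -> (w ⊩ ChurchSucc c) -> (w ⊩ ChurchZero o) ->
  (w ⊩ Func j) -> (w ⊩ Iter j c o k) -> w ⊩ k ≡ j.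
Proof.
  intros H Hc Ho Hj Hk. fdestruct Hk as [p [Hp [Hcp Hok]]]. apply ext. fintros t. fsplit.
  - fintros Ht. apply (iff_l _ _ _ (all_e _ _ H t)). fexists k. fsplit; [|exact Ht].
    fdestruct Hok as [v [Hv Hvp]]. fdestruct Hcp as [q [Hq Hqj]].
    fexists v. fsplit; [exact (iff_r _ _ _ (class_pair_ChurchZero Ho) Hv)|].
    fexists p. fsplit; [|exact Hvp]. fexists q.
    fsplit; [exact (iff_r _ _ _ (class_pair_ChurchSucc Hc) Hq)|exact Hqj].
  - fintros Ht. pose proof (iff_r _ _ _ (all_e _ _ H t) Ht) as K. clear Ht.
    fdestruct K as [y [[v [Hv [p' [[q [Hq Hqj]] Hvp]]]] Ht]].
    pose proof (iff_l _ _ _ (class_pair_ChurchZero Ho) Hv) as Hv'.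
    pose proof (iff_l _ _ _ (class_pair_ChurchSucc Hc) Hq) as Hq'.
    (* [Ap] is a union over all values; functionality of [j], then of [p], identifies the values
       found with [p] and [k]. *)
    pose proof (Func_e Hj (pair_in_i Hq' Hqj) Hcp) as E.
    clear Hq Hq' Hqj. fsubst E.
    pose proof (Func_e Hp (pair_in_i Hv' Hvp) Hok) as E.
    clear Hv Hv' Hvp. fsubst E. exact Ht.
Qed.

Lemma church_implies_rosser {w} :
  w ⊩ (∀ j, ChurchNum j ⇒ counting_at j) ⇒ ∀ x, FregeNum x ⇒ ∃ s, Seg s x ∧ s ∈ x.
Proof.
  fintros H x Hx. fobtain ChurchNum_ex as [n Hn]. fobtain FregeSuccGraph_ex as [g Hg].
  fobtain Zero_ex as [z Hz].
  fobtain ChurchSucc_ex as [c Hc]. fobtain ChurchZero_ex as [o Ho].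
  fobtain (FregeNum_Iter Hn Hg Hz Hx) as [j [Hj Hjx]]. fapply Hn in Hj.
  (* The two copies of the successor graph and of zero may coincide here, as the comprehension lies
     behind. *)
  fobtain (iteration_shift Hc Ho Hg Hg Hz Hz Hj) as [Hfj [k [Hk [Hjk HR]]]].
  fhave Hcj : (counting_at j) by (fapply H; exact Hj).
  pose proof (counting_eq Hcj Hc Ho Hfj Hjk) as E. fsubst E.
  fobtain (FregeNum_inhabited Hx) as [a Ha].
  fhave K : (∃ u, SegCard3 x u ∧ Iter j g z u) by (fapply HR; [exact Hjx|exact Ha]).
  fdestruct K as [u [Hxu Hju]]. pose proof (Iter_fun Hfj Hju Hjx) as E. fsubst E.
  fdestruct Hxu as [y [v [H1 [H2 H3]]]].
  fobtain (SegCard_cycle H1 H2 H3) as [_ [_ [s [Hs Hsx]]]].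
  fexists s. fsplit; assumption.
Qed.

Theorem theorem21p11 :
  provable INF (sentence (fImp church_counting rosser_counting)).
Proof.
  unfold provable. rewrite <- (ren_id _ (fun n => n)) by reflexivity.
  apply adequacy.
  (* Once computed, the sentence is an explicit formula whose value is convertible to the statement
     of [church_implies_rosser]. *)
  lazymatch goal with |- holds ?w (ev ?A ?r) =>
    let A' := eval cbv in A in change (holds w (ev A' r)) end.
  exact church_implies_rosser.
Qed.
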